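(* If a configuration $C=p_r\dots p_s$ of g-2PATH satisfies the condition of noninterference of extensions (CNI), then \[\mathrm{mft}_{\text{g-2PATH}}(C)=\min_{r\le i\le0\le j\le s}\max\{-2i+j+g(i,j),\ 2j-i+f(i,j)\}.\]
   Context: Positions are elements of $\mathbb{Z}^2$; with $\epsilon_0=(1,0),\epsilon_1=(0,1),\epsilon_2=(-1,0),\epsilon_3=(0,-1)$, positions $p,p'$ are adjacent if $p'-p$ is some $\epsilon_i$. A configuration of g-2PATH is a sequence $C=p_r\dots p_s$ ($r\le0\le s$) of positions with $p_0=(0,0)$ (the general), consecutive positions adjacent, all positions distinct, and $p_l,p_m$ not adjacent whenever $|l-m|\ge2$; it is identified with its set of positions. For $p\in C$, $\mathrm{bc}_C(p)=(b_0,\dots,b_3)\in\{0,1\}^4$ with $b_i=1$ iff $p+\epsilon_i\in C$. Firing squad model (boundary-sensitive): a finite automaton $A$ has a finite state set containing a quiescent state $\mathrm{Q}$, general states $\mathrm{G}_0,\dots,\mathrm{G}_{m-1}$, a set $\mathcal F$ of firing states with $\mathrm{Q}\notin\mathcal F$, a map $\tau:\{0,1\}^4\to\{0,\dots,m-1\}$, and a transition function computing the next state from the current state and the states of the four neighbours (the symbol $\#$ where there is no node), such that a node in $\mathrm{Q}$ with all inputs in $\{\mathrm{Q},\#\}$ stays in $\mathrm{Q}$. With a copy of $A$ at each position of $C$, at time $0$ the node $(0,0)$ is in $\mathrm{G}_{\tau(\mathrm{bc}_C((0,0)))}$ and all others in $\mathrm{Q}$; nodes update synchronously. $A$ is a solution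 of g-2PATH if for every configuration $C$ there is $t_C$ such that no node is in $\mathcal F$ before $t_C$ and all nodes are in $\mathcal F$ at $t_C$; $\mathrm{ft}(C,A)=t_C$. $\mathrm{mft}_{\text{g-2PATH}}(C)=\min_A\mathrm{ft}(C,A)$ over all solutions. For fixed $C$ and $r\le i\le0\le j\le s$: $W(i,j)$ is the set of pairs $(x_0,x_1)$ of finite, possibly empty, sequences of positions such that $x_0p_i\dots p_jx_1$ is a configuration $C'$ of g-2PATH (general at $p_0$) with $\mathrm{bc}_{C'}(p_l)=\mathrm{bc}_C(p_l)$ for all $i\le l\le j$; $U(i,j)$, $V(i,j)$ are the sets of first, resp. second, components of elements of $W(i,j)$; $f(i,j)=\sup\{|x_0|:x_0\in U(i,j)\}$, $g(i,j)=\sup\{|x_1|:x_1\in V(i,j)\}$ ($|x|$ = number of positions; values may be $\infty$, and $\max\{a,\infty\}=\infty$). $\mathrm{NI}(i,j)$ means $W(i,j)=U(i,j)\times V(i,j)$. $I=\{(i,j): r\le i-1,\ W(i,j)$ infinite, $W(i-1,j)$ finite$\}$, $J=\{(i,j): j+1\le s,\ W(i,j)$ infinite, $W(i,j+1)$ finite$\}$, $K=\{(i,j): W(i,j)$ finite$\}$. $C$ satisfies CNI if $\mathrm{NI}(i,j)$ holds for all $(i,j)\in I\cup J\cup K$. *)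

(* Defs.v *)
From Stdlib Require Import ClassicalEpsilon.
From HB Require Import structures.
From mathcomp Require Import all_boot all_order all_algebra.
Set Implicit Arguments. Unset Strict Implicit. Unset Printing Implicit Defensive.
Import Order.TTheory GRing.Theory Num.Theory.

Definition pos := (int * int)%type.
Definition p0 : pos := (0%R, 0%R).
Definition padd (p q : pos) : pos := (p.1 + q.1, p.2 + q.2)%R.

Definition epsn (n : nat) : pos :=
  match n with
  | O => (1%R, 0%R)
  | S O => (0%R, 1%R)
  | S (S O) => ((-1)%R, 0%R)
  | _ => (0%R, (-1)%R)
  end.

Definition adj (p q : pos) : bool := [exists e : 'I_4, q == padd p (epsn e)].

(* ---------- configurations ----------
   A configuration p_r ... p_s (r <= 0 <= s) is represented by the list
   L = [p_r; ...; p_s] together with k = -r, the index of the general p_0. *)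
Definition is_config (L : seq pos) (k : nat) : Prop :=
  [/\ (k < size L)%N,
      nth p0 L k = p0,
      (forall a, (a.+1 < size L)%N -> adj (nth p0 L a) (nth p0 L a.+1)),
      uniq L &
      (forall a b, (a < size L)%N -> (b < size L)%N ->
         ((a.+2 <= b)%N || (b.+2 <= a)%N) -> ~~ adj (nth p0 L a) (nth p0 L b))].

Definition rr (k : nat) : int := (- (k%:Z))%R.
Definition ss (L : seq pos) (k : nat) : int := ((size L)%:Z - 1 - k%:Z)%R.
Definition pt (L : seq pos) (k : nat) (l : int) : pos := nth p0 L (absz (k%:Z + l)%R).
Definition seg (L : seq pos) (k : nat) (i j : int) : seq pos :=
  take (absz (j - i + 1)%R) (drop (absz (k%:Z + i)%R) L).

Definition bc (L : seq pos) (p : pos) : bool * bool * bool * bool :=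
  (padd p (epsn 0) \in L, padd p (epsn 1) \in L,
   padd p (epsn 2) \in L, padd p (epsn 3) \in L).

(* ---------- extended naturals N ∪ {∞} as option nat (None = ∞) ---------- *)
Definition esup (P : nat -> Prop) : option nat :=
  match excluded_middle_informative (exists b, forall n, P n -> (n <= b)%N) with
  | left _ => Some (epsilon (inhabits 0%N)
       (fun b => (forall n, P n -> (n <= b)%N) /\
                 (forall b', (forall n, P n -> (n <= b')%N) -> (b <= b')%N)))
  | right _ => None
  end.
Definition eadd (n : nat) (v : option nat) : option nat := omap (addn n) v.
Definition emax (v w : option nat) : option nat :=
  match v, w with Some a, Some b => Some (maxn a b) | _, _ => None end.

Definition W (L : seq pos) (k : nat) (i j : int) (x : seq pos * seq pos) : Prop :=
  let C' := x.1 ++ seg L k i j ++ x.2 in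
  is_config C' (size x.1 + absz (- i)%R) /\
  (forall l : int, (i <= l <= j)%R -> bc C' (pt L k l) = bc L (pt L k l)).
Definition U L k i j (x0 : seq pos) : Prop := exists x1, W L k i j (x0, x1).
Definition V L k i j (x1 : seq pos) : Prop := exists x0, W L k i j (x0, x1).
Definition f L k i j : option nat := esup (fun n => exists x0, U L k i j x0 /\ size x0 = n).
Definition g L k i j : option nat := esup (fun n => exists x1, V L k i j x1 /\ size x1 = n).

Definition finite_set (P : seq pos * seq pos -> Prop) : Prop :=
  exists s : seq (seq pos * seq pos), forall x, P x -> x \in s.

Definition NI L k i j : Prop :=
  forall x0 x1, W L k i j (x0, x1) <-> (U L k i j x0 /\ V L k i j x1).

Definition in_range (L : seq pos) (k : nat) (i j : int) : bool :=
  [&& (rr k <= i)%R, (i <= 0)%R, (0 <= j)%R & (j <= ss L k)%R].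

Definition inI L k i j : Prop :=
  (rr k <= i - 1)%R /\ ~ finite_set (W L k i j) /\ finite_set (W L k (i - 1)%R j).
Definition inJ L k i j : Prop :=
  (j + 1 <= ss L k)%R /\ ~ finite_set (W L k i j) /\ finite_set (W L k i (j + 1)%R).
Definition inK L k i j : Prop := finite_set (W L k i j).

Definition CNI (L : seq pos) (k : nat) : Prop :=
  forall i j, in_range L k i j -> (inI L k i j \/ inJ L k i j \/ inK L k i j) ->
    NI L k i j.

Definition value L k (i j : int) : option nat :=
  emax (eadd (absz (- (2 * i) + j)%R) (g L k i j))
       (eadd (absz (2 * j - i)%R) (f L k i j)).

Definition is_min_value L k (t : nat) : Prop :=
  (exists i j, in_range L k i j /\ value L k i j = Some t) /\
  (forall i j, in_range L k i j ->
     match value L k i j with Some n => (t <= n)%N | None => true end).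

Definition quiet_input (Q : eqType) (q0 : Q) (o : option Q) : bool :=
  match o with None => true | Some x => x == q0 end.

Record automaton := Automaton {
  st : finType;
  quiescent : st;
  ngen : nat;
  gen : 'I_ngen -> st;
  firing : pred st;
  tau : bool * bool * bool * bool -> 'I_ngen;
  (* next state from own state and the states of the neighbours in
     directions eps_0, eps_1, eps_2, eps_3 (None = #) *)
  delta : st -> option st -> option st -> option st -> option st -> st;
  quiescent_not_firing : ~~ firing quiescent;
  quiescent_stable : forall a b c d,
    quiet_input quiescent a -> quiet_input quiescent b ->
    quiet_input quiescent c -> quiet_input quiescent d ->
    delta quiescent a b c d = quiescent
}.

Fixpoint run (A : automaton) (L : seq pos) (t : nat) (q : pos) : st A :=
  match t with
  | O => if q == p0 then @gen A (@tau A (bc L p0)) else @quiescent A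
  | S t' =>
      let nb e := let q' := padd q (epsn e) in
                  if q' \in L then Some (run A L t' q') else None in
      @delta A (run A L t' q) (nb 0%N) (nb 1%N) (nb 2%N) (nb 3%N)
  end.

Definition fires_at (A : automaton) (L : seq pos) (t : nat) : Prop :=
  (forall t', (t' < t)%N -> forall q, q \in L -> ~~ @firing A (run A L t' q)) /\
  (forall q, q \in L -> @firing A (run A L t q)).

Definition solution (A : automaton) : Prop :=
  forall L k, is_config L k -> exists t, fires_at A L t.

Definition mft_is (L : seq pos) (t : nat) : Prop :=
  (exists A, solution A /\ fires_at A L t) /\
  (forall A t', solution A -> fires_at A L t' -> (t <= t')%N).

(* Main.v *)
(** Lower bound.  In a configuration [x0 p_i ... p_j x1] the nodes of [p_i ... p_j x1] cannot
    distinguish two choices of [x0] until the news of the position before [p_i] reach them.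
    If [T] is smaller than every value of the formula, this lets one walk from the interval
    [r, s] towards [0, 0], shrinking the interval at one of its two ends, while preserving the
    following fact: for some [x1], every extension [(x0, x1)] of [p_i ... p_j] fires at time [T]
    as soon as [C] does, and symmetrically for some [x0].  Noninterference makes the left and
    right components exchangeable.  The walk ends at an extension that has a node at distance
    more than [T] from the general, and such a node is still quiescent at time [T].

    Upper bound.  Let [(i, j)] have the finite value [T].  During the first [T] steps the nodes
    collect which of the positions [p_i, ..., p_j] exist with the right boundary conditions.
    At time [T] either all nodes or none of them know that the configuration extends
    [p_i ... p_j].  In the first case they fire, in the second case an arbitrary solution is
    started at time [T + 1].  For the latter, a token goes to one end of the path and comes
    back to the other end, orienting the path, and then the segments are repeatedly split at
    their midpoints, found by signals of speeds 1 and 1/3. *)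
From Stdlib Require Import FunctionalExtensionality Classical ClassicalEpsilon.
Require Import Defs.
From mathcomp Require Import all_boot all_order all_algebra zify.
Set Implicit Arguments. Unset Strict Implicit. Unset Printing Implicit Defensive.
Import GRing.Theory.

(** * Paths and runs *)

Definition dist (a b : nat) : nat := (a - b) + (b - a).

Definition opp (e : 'I_4) : 'I_4 := inord ((e + 2) %% 4).

Lemma ord4_case (P : 'I_4 -> Prop) :
  P (@Ordinal 4 0 isT) -> P (@Ordinal 4 1 isT) -> P (@Ordinal 4 2 isT) ->
  P (@Ordinal 4 3 isT) -> forall e, P e.
Proof.
move=> h0 h1 h2 h3 [[|[|[|[|m]]]] hm] //.
- by rewrite (bool_irrelevance hm isT).
- by rewrite (bool_irrelevance hm isT).
- by rewrite (bool_irrelevance hm isT).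
- by rewrite (bool_irrelevance hm isT).
Qed.

Lemma padd_opp p (e : 'I_4) : padd (padd p (epsn e)) (epsn (opp e)) = p.
Proof.
case: p => x y; move: e; apply: ord4_case; rewrite /padd /opp inordK //=;
  congr pair; lia.
Qed.

Lemma padd_inj p (e e' : 'I_4) : padd p (epsn e) = padd p (epsn e') -> e = e'.
Proof.
case: p => x y; rewrite /padd; case=> h1 h2; apply: val_inj; move: e e' h1 h2.
by apply: ord4_case; apply: ord4_case => //=; lia.
Qed.

Lemma padd_injl e p q : padd p (epsn e) = padd q (epsn e) -> p = q.
Proof. by case: p q => [x y] [x' y'] [] /addIr-> /addIr->. Qed.

Lemma padd_neq p (e : 'I_4) : padd p (epsn e) != p.
Proof.
case: p => x y; move: e; apply: ord4_case; rewrite /padd /= xpair_eqE;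
  apply/negP; lia.
Qed.

Lemma adjP p q : reflect (exists e : 'I_4, q = padd p (epsn e)) (adj p q).
Proof.
by apply: (iffP existsP) => -[e he]; exists e; apply/eqP; rewrite // he.
Qed.

Lemma adj_sym p q : adj p q = adj q p.
Proof.
suff H u v : adj u v -> adj v u by apply/idP/idP; apply: H.
by case/adjP=> e ->; apply/adjP; exists (opp e); rewrite padd_opp.
Qed.

Lemma config_adj L k a b : is_config L k -> a < size L -> b < size L ->
  adj (nth p0 L a) (nth p0 L b) = (a == b.+1) || (b == a.+1).
Proof.
case=> _ _ hadj uL hna ha hb; apply/idP/idP.
  move=> hab; have : ~~ ((a.+2 <= b) || (b.+2 <= a)).
    by apply/negP => h; move/negP: (hna a b ha hb h).
  have : a != b.
    apply/negP => /eqP eab; move: hab; rewrite eab => /adjP[e he].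
    by move: (padd_neq (nth p0 L b) e); rewrite -he eqxx.
  lia.
case/orP=> /eqP e; first by rewrite e adj_sym; apply: hadj; rewrite -e.
by rewrite e; apply: hadj; rewrite -e.
Qed.

Lemma config_rev L k : is_config L k -> is_config (rev L) (size L - k.+1).
Proof.
move=> C; have [hk h0 hadj uL hna] := C.
split; rewrite ?size_rev.
- lia.
- rewrite nth_rev; last lia.
  by rewrite (_ : _ - _ = k) //; lia.
- move=> a ha; rewrite !nth_rev; try lia.
  rewrite (config_adj C); lia.
- by rewrite rev_uniq.
- move=> a b ha hb hab; rewrite !nth_rev // (config_adj C); lia.
Qed.

Lemma config_nb L k a (e : 'I_4) : is_config L k -> a < size L ->
  padd (nth p0 L a) (epsn e) \in L ->
  exists b, [/\ b < size L, (a == b.+1) || (b == a.+1) &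
                padd (nth p0 L a) (epsn e) = nth p0 L b].
Proof.
move=> C ha /(nthP p0)[b hb eb]; exists b; split=> //.
by rewrite -(config_adj C) //; apply/adjP; exists e.
Qed.

Definition dir (L : seq pos) (a b : nat) : 'I_4 :=
  odflt ord0 [pick e : 'I_4 | nth p0 L b == padd (nth p0 L a) (epsn e)].

Lemma dirE L k a b : is_config L k -> a < size L -> b < size L ->
  (a == b.+1) || (b == a.+1) ->
  nth p0 L b = padd (nth p0 L a) (epsn (dir L a b)).
Proof.
move=> C ha hb; rewrite -(config_adj C) // => /adjP[e he].
by rewrite /dir; case: pickP => [x /eqP //|/(_ e)]; rewrite -he eqxx.
Qed.

Lemma dir_uniq L k a b (e : 'I_4) : is_config L k -> a < size L -> b < size L ->
  nth p0 L b = padd (nth p0 L a) (epsn e) -> e = dir L a b.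
Proof.
move=> C ha hb he; rewrite /dir; case: pickP => [x /eqP|/(_ e)].
  by rewrite he => /padd_inj.
by rewrite -he eqxx.
Qed.

Lemma dir_opp L k a b : is_config L k -> a < size L -> b < size L ->
  (a == b.+1) || (b == a.+1) -> opp (dir L a b) = dir L b a.
Proof.
move=> C ha hb hab; apply: (dir_uniq C) => //.
by rewrite (dirE C ha hb hab) padd_opp.
Qed.

Lemma dir_neq L k a : is_config L k -> 0 < a -> a.+1 < size L ->
  dir L a a.-1 != dir L a a.+1.
Proof.
move=> C a0 ha; apply/negP => /eqP e.
have h1 : nth p0 L a.-1 = padd (nth p0 L a) (epsn (dir L a a.-1)).
  by apply: (dirE C); lia.
have h2 : nth p0 L a.+1 = padd (nth p0 L a) (epsn (dir L a a.+1)).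
  by apply: (dirE C); lia.
have [_ _ _ uL _] := C.
move/eqP: (etrans h1 (etrans (congr1 (fun e : 'I_4 => padd _ (epsn e)) e) (esym h2))).
rewrite nth_uniq //; first lia.
by apply: leq_trans ha; lia.
Qed.

Lemma dir_predE L k x : is_config L k -> 0 < x -> x < size L ->
  padd (nth p0 L x) (epsn (dir L x x.-1)) = nth p0 L x.-1.
Proof.
move=> C x0 hx; rewrite -(dirE C) //; first by rewrite (leq_ltn_trans (leq_pred x)).
by rewrite prednK ?eqxx.
Qed.

Lemma dir_succE L k x : is_config L k -> x.+1 < size L ->
  padd (nth p0 L x) (epsn (dir L x x.+1)) = nth p0 L x.+1.
Proof. by move=> C hx; rewrite -(dirE C) // ?eqxx ?orbT // ltnW. Qed.

(** The four inputs of node [x] in terms of path indices. Only consecutive positions of a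
    configuration are adjacent in the plane, so a run in the plane becomes a run on a path whose
    nodes have ports. *)
Definition nbf (S : Type) (L : seq pos) (s : nat -> S) (x : nat) (e : 'I_4) : option S :=
  if (0 < x) && (e == dir L x x.-1) then Some (s x.-1)
  else if (x.+1 < size L) && (e == dir L x x.+1) then Some (s x.+1) else None.

Lemma nbf_mem S L k (s : nat -> S) x (e : 'I_4) : is_config L k -> x < size L ->
  (padd (nth p0 L x) (epsn e) \in L) = isSome (nbf L s x e).
Proof.
move=> C hx; rewrite /nbf; apply/idP/idP.
  case/(config_nb C hx) => b [hb hbx eb].
  have ee := dir_uniq C hx hb (esym eb).
  case/orP: hbx => /eqP h.
    by subst x; rewrite /= ee eqxx.
  by case: ifP => // _; rewrite -h ee hb eqxx.
case: ifP => [/andP[x0 /eqP->] _|_].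
  by rewrite (dir_predE C) // mem_nth // (leq_ltn_trans (leq_pred x)).
case: ifP => [/andP[x0 /eqP->] _|_] //.
by rewrite (dir_succE C) // mem_nth.
Qed.

Lemma nbfE S L k (r : pos -> S) x (e : 'I_4) : is_config L k -> x < size L ->
  (if padd (nth p0 L x) (epsn e) \in L then Some (r (padd (nth p0 L x) (epsn e)))
   else None) = nbf L (fun y => r (nth p0 L y)) x e.
Proof.
move=> C hx; rewrite (nbf_mem (fun y => r (nth p0 L y)) _ C hx) /nbf.
case: (boolP ((0 < x) && _)) => [/andP[x0 /eqP->]|_] /=.
  by rewrite (dir_predE C).
case: (boolP (_ && _)) => [/andP[x0 /eqP->]|_] //=.
by rewrite (dir_succE C).
Qed.

Definition e0 : 'I_4 := @Ordinal 4 0 isT.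
Definition e1 : 'I_4 := @Ordinal 4 1 isT.
Definition e2 : 'I_4 := @Ordinal 4 2 isT.
Definition e3 : 'I_4 := @Ordinal 4 3 isT.

Definition fun4 (S : Type) (a b c d : option S) (e : 'I_4) : option S :=
  nth None [:: a; b; c; d] e.

Lemma fun4E S (u : 'I_4 -> option S) : fun4 (u e0) (u e1) (u e2) (u e3) = u.
Proof. by apply: functional_extensionality; apply: ord4_case. Qed.

Lemma run_step A L k t x : is_config L k -> x < size L ->
  let u := nbf L (fun y => run A L t (nth p0 L y)) x in
  run A L t.+1 (nth p0 L x) =
  @delta A (run A L t (nth p0 L x)) (u e0) (u e1) (u e2) (u e3).
Proof.
by move=> C hx u; rewrite /u -!(nbfE (run A L t) _ C hx).
Qed.

Lemma bc_nbf S L k (s : nat -> S) x : is_config L k -> x < size L ->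
  let u := nbf L s x in
  bc L (nth p0 L x) = (isSome (u e0), isSome (u e1), isSome (u e2), isSome (u e3)).
Proof. by move=> C hx u; rewrite /u -!(nbf_mem s _ C hx). Qed.

Lemma nbfP S L (s : nat -> S) x e v : x < size L -> nbf L s x e = Some v ->
  exists y, [/\ y < size L, (x == y.+1) || (y == x.+1), e = dir L x y & v = s y].
Proof.
move=> hx; rewrite /nbf; case: ifP => [/andP[x0 /eqP->] [<-]|_].
  by exists x.-1; split=> //; lia.
by case: ifP => // /andP[x0 /eqP->] [<-]; exists x.+1; split=> //; lia.
Qed.

Lemma nbf_some S L k (s : nat -> S) x y : is_config L k -> x < size L -> y < size L ->
  (x == y.+1) || (y == x.+1) -> nbf L s x (dir L x y) = Some (s y).
Proof.
move=> C hx hy /orP[] /eqP h; rewrite /nbf.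
  by subst x; rewrite /= eqxx.
case: ifP => [/andP[x0 /eqP e]|_].
  by move: (dir_neq C x0); rewrite -e -h eqxx => /(_ hy).
by rewrite -h hy eqxx.
Qed.

(** The list enters a run only through membership. Hence reversing it changes nothing, and arguments
    for one side of the path can be mirrored. *)
Lemma run_mem A L L' t q : L =i L' -> run A L t q = run A L' t q.
Proof.
move=> e; have eb p : bc L p = bc L' p by rewrite /bc !e.
by elim: t q => [|t IH] q /=; rewrite ?eb // !e !IH.
Qed.

Lemma fires_mem A L L' t : L =i L' -> fires_at A L t -> fires_at A L' t.
Proof.
move=> e [h1 h2]; split=> [t' ht q|q]; rewrite -e -(run_mem _ _ _ e); last exact: h2.
exact: h1.
Qed.

Lemma bc_mem L L' p : L =i L' -> bc L p = bc L' p.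
Proof. by move=> e; rewrite /bc !e. Qed.

Lemma config_eq0 L k x : is_config L k -> x < size L -> (nth p0 L x == p0) = (x == k).
Proof. by case=> hk h0 _ uL _ hx; rewrite -{2}h0 nth_uniq. Qed.

Lemma run_quiet A L k t x : is_config L k -> x < size L -> t < dist x k ->
  run A L t (nth p0 L x) = @quiescent A.
Proof.
rewrite /dist => C; elim: t x => [|t IH] x hx hd.
  by rewrite /= (config_eq0 C) //; case: eqP => //; lia.
rewrite (run_step _ _ C) // IH //; last lia.
have qt e : quiet_input (@quiescent A) (nbf L (fun y => run A L t (nth p0 L y)) x e).
  case E : nbf => [v|] //=; case: (nbfP hx E) => y [hy hyx _ ->].
  by rewrite IH //; lia.
exact: quiescent_stable.
Qed.

(** * Lower bound *)

Section Suffix.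

Variables (A : automaton) (D : seq pos) (a : nat).

Section Prefixes.

Variables (y1 y2 : seq pos).
Hypothesis C1 : is_config (y1 ++ D) (size y1 + a).
Hypothesis C2 : is_config (y2 ++ D) (size y2 + a).
Hypothesis bcE : bc (y1 ++ D) (nth p0 D 0) = bc (y2 ++ D) (nth p0 D 0).

Lemma nth_suffix (y : seq pos) n : nth p0 (y ++ D) (size y + n) = nth p0 D n.
Proof. by rewrite nth_cat ltnNge leq_addr addKn. Qed.

(** At the first node of [D] the shared boundary condition decides; a later node of [D] has all its
    neighbours in [D]. *)
Lemma suffix_mem1 n (e : 'I_4) : n < size D ->
  padd (nth p0 D n) (epsn e) \in y1 ++ D -> padd (nth p0 D n) (epsn e) \in y2 ++ D.
Proof.
move=> hn; have [n0|n0] := posnP n.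
  rewrite n0; move: bcE; rewrite /bc => -[] h0 h1 h2 h3; move: e.
  by apply: ord4_case; rewrite /= ?h0 ?h1 ?h2 ?h3.
have hx : size y1 + n < size (y1 ++ D) by rewrite size_cat ltn_add2l.
rewrite -(nth_suffix y1) => /(config_nb C1 hx)[b [hb hbn ->]].
have hb' : size y1 <= b by lia.
rewrite -(subnKC hb') nth_suffix mem_cat mem_nth ?orbT //.
by rewrite -(ltn_add2l (size y1)) subnKC // -size_cat.
Qed.

(** A neighbour outside [D] can only be the last position of the prefix, at distance [a.+1] from the
    general. *)
Lemma suffix_quiet n (e : 'I_4) t : n < size D -> t < a.+1 ->
  padd (nth p0 D n) (epsn e) \in y1 ++ D -> padd (nth p0 D n) (epsn e) \notin D ->
  n = 0 /\ run A (y1 ++ D) t (padd (nth p0 D n) (epsn e)) = @quiescent A.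
Proof.
move=> hn ht; have hx : size y1 + n < size (y1 ++ D) by rewrite size_cat ltn_add2l.
rewrite -(nth_suffix y1) => /(config_nb C1 hx)[b [hb hbn ->]].
have [hb'|hb'] := leqP (size y1) b.
  rewrite -(subnKC hb') nth_suffix mem_nth //.
  by rewrite -(ltn_add2l (size y1)) subnKC // -size_cat.
move=> _; split; first lia.
by rewrite (run_quiet _ C1) // /dist; lia.
Qed.

End Prefixes.

Lemma suffix_notin y1 y2 n (e : 'I_4) : n < size D ->
  is_config (y1 ++ D) (size y1 + a) -> is_config (y2 ++ D) (size y2 + a) ->
  bc (y1 ++ D) (nth p0 D 0) = bc (y2 ++ D) (nth p0 D 0) ->
  (padd (nth p0 D n) (epsn e) \in y1 ++ D) = (padd (nth p0 D n) (epsn e) \in y2 ++ D).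
Proof. by move=> hn C1 C2 h; apply/idP/idP; apply: suffix_mem1. Qed.

(* The nodes of the common suffix [D] are blind to the prefix until the news of its last
   position, which is at distance [a + 1] from the general, reach them. *)
Lemma run_suffix y1 y2 n t : a < size D -> n < size D -> t < n + a + 2 ->
  is_config (y1 ++ D) (size y1 + a) -> is_config (y2 ++ D) (size y2 + a) ->
  bc (y1 ++ D) (nth p0 D 0) = bc (y2 ++ D) (nth p0 D 0) ->
  run A (y1 ++ D) t (nth p0 D n) = run A (y2 ++ D) t (nth p0 D n).
Proof.
move=> ha + + C1 C2 bcE; elim: t n => [|t IH] n hn ht.
  rewrite /=; case: eqP => // e; congr (@gen A (@tau A _)).
  by rewrite -e /bc !(suffix_notin e0 hn C1 C2 bcE, suffix_notin e1 hn C1 C2 bcE,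
    suffix_notin e2 hn C1 C2 bcE, suffix_notin e3 hn C1 C2 bcE).
have nbE (e : 'I_4) : (if padd (nth p0 D n) (epsn e) \in y1 ++ D then
     Some (run A (y1 ++ D) t (padd (nth p0 D n) (epsn e))) else None) =
  (if padd (nth p0 D n) (epsn e) \in y2 ++ D then
     Some (run A (y2 ++ D) t (padd (nth p0 D n) (epsn e))) else None).
  have E := suffix_notin e hn C1 C2 bcE; rewrite -E; case: ifP => // m1; congr Some.
  have m2 : padd (nth p0 D n) (epsn e) \in y2 ++ D by rewrite -E.
  case: (boolP (padd (nth p0 D n) (epsn e) \in D)) => [|nD].
    (* A neighbour in [D] has index at least [n.-1], so at time [t] it is still blind to the
       prefix. *)
    case/(nthP p0) => m hm em; rewrite -em; apply: IH => //.
    have hx : size y1 + n < size (y1 ++ D) by rewrite size_cat ltn_add2l.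
    have hy : size y1 + m < size (y1 ++ D) by rewrite size_cat ltn_add2l.
    have : adj (nth p0 (y1 ++ D) (size y1 + n)) (nth p0 (y1 ++ D) (size y1 + m)).
      by rewrite !nth_suffix; apply/adjP; exists e.
    by rewrite (config_adj C1 hx hy); lia.
  have [h|h] := ltnP t a.+1.
    by rewrite (suffix_quiet C1 hn h m1 nD).2 (suffix_quiet C2 hn h m2 nD).2.
  (* From time [a.+1] on, the bound on [t.+1] forces [n] to be positive, whereas a neighbour outside
     [D] requires [n = 0]. *)
  by have [n0 _] := suffix_quiet (t := 0) C1 hn isT m1 nD; lia.
by rewrite /= IH; [rewrite (nbE e0) (nbE e1) (nbE e2) (nbE e3)|done|lia].
Qed.

End Suffix.

(** All nodes fire together, so the history of a single common node decides the firing time. *)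
Lemma fires_transfer A L1 L2 T q : (exists t, fires_at A L2 t) -> q \in L1 -> q \in L2 ->
  (forall t, t <= T -> run A L1 t q = run A L2 t q) ->
  fires_at A L1 T -> fires_at A L2 T.
Proof.
move=> [t h2] q1 q2 E [h1 h1']; have [tT|tT|<-//] := ltngtP t T.
  by move: (h1 t tT q q1); rewrite E ?(ltnW tT) // (h2.2 q q2).
by move: (h2.1 T tT q q2); rewrite -E // (h1' q q1).
Qed.

Lemma fires_dist A L k T x : is_config L k -> x < size L -> fires_at A L T -> dist x k <= T.
Proof.
move=> C hx [_ /(_ _ (mem_nth p0 hx))]; rewrite leqNgt => h; apply/negP => d.
by move: h; rewrite (run_quiet _ C) // (negbTE (@quiescent_not_firing A)).
Qed.

(* The part [p_(-a) ... p_b] of [L], with the index of the general in [L] being [k]. *)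
Definition mid (L : seq pos) (k a b : nat) : seq pos := take (a + b).+1 (drop (k - a) L).

(** The relation [W] for [i = -a] and [j = b], in natural number indices. *)
Definition ext (L : seq pos) (k a b : nat) (x0 x1 : seq pos) : Prop :=
  is_config (x0 ++ mid L k a b ++ x1) (size x0 + a) /\
  forall c, k - a <= c <= k + b ->
    bc (x0 ++ mid L k a b ++ x1) (nth p0 L c) = bc L (nth p0 L c).

Section Mid.

Variables (L : seq pos) (k a b : nat).
Hypotheses (C : is_config L k) (ak : a <= k) (bk : k + b < size L).

Lemma size_mid : size (mid L k a b) = (a + b).+1.
Proof. rewrite size_take size_drop; case: ifP; lia. Qed.

Lemma nth_mid m : m <= a + b -> nth p0 (mid L k a b) m = nth p0 L (k - a + m).
Proof. by move=> hm; rewrite nth_take // nth_drop. Qed.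

Lemma mid_split : L = take (k - a) L ++ mid L k a b ++ drop (k + b).+1 L.
Proof.
rewrite -{1}(cat_take_drop (k - a) L); congr cat.
rewrite -{1}(cat_take_drop (a + b).+1 (drop (k - a) L)); congr cat.
by rewrite drop_drop; congr drop; lia.
Qed.

Lemma ext_self : ext L k a b (take (k - a) L) (drop (k + b).+1 L).
Proof.
split; rewrite -mid_split // size_take (_ : k - a < size L); last lia.
by rewrite subnK.
Qed.

Lemma midS : 0 < a -> mid L k a b = nth p0 L (k - a) :: mid L k a.-1 b.
Proof.
move=> a0; rewrite /mid (drop_nth p0); last lia.
rewrite (_ : (a + b).+1 = (a.-1 + b).+2) /=; last lia.
by rewrite (_ : (k - a).+1 = k - a.-1) //; lia.
Qed.

Lemma ext_left x0 x1 : 0 < a -> ext L k a b x0 x1 ->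
  ext L k a.-1 b (rcons x0 (nth p0 L (k - a))) x1 /\
  rcons x0 (nth p0 L (k - a)) ++ mid L k a.-1 b ++ x1 = x0 ++ mid L k a b ++ x1.
Proof.
move=> a0 [Cx hx]; have e : rcons x0 (nth p0 L (k - a)) ++ mid L k a.-1 b ++ x1 =
    x0 ++ mid L k a b ++ x1 by rewrite midS // cat_rcons.
split=> //; split; rewrite e.
  by rewrite size_rcons (_ : _ + _ = size x0 + a) //; lia.
by move=> c hc; apply: hx; lia.
Qed.

End Mid.

(** The last position of a nonempty [x0] would be adjacent to the end [p_r]. The boundary condition
    there puts it in [L], hence in the rest of the configuration, which contradicts distinctness. *)
Lemma end_nil L k b x0 x1 : k + b < size L -> {subset L <= mid L k k b ++ x1} ->
  ext L k k b x0 x1 -> x0 = [::].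
Proof.
move=> bk; case: x0 / (lastP x0) => // x0 p sL [Cx hx].
have sm := size_mid (leqnn k) bk.
have hs1 : (size x0).+1 < size (rcons x0 p ++ mid L k k b ++ x1).
  by rewrite !size_cat size_rcons sm; lia.
have n1 : nth p0 (rcons x0 p ++ mid L k k b ++ x1) (size x0) = p.
  by rewrite nth_cat size_rcons ltnSn nth_rcons ltnn eqxx.
have n2 : nth p0 (rcons x0 p ++ mid L k k b ++ x1) (size x0).+1 = nth p0 L 0.
  by rewrite nth_cat size_rcons ltnn subnn nth_cat sm nth_mid // subnn.
have := config_adj Cx hs1 (ltnW hs1); rewrite eqxx n1 n2 /= => /adjP[e' pE].
have := hx 0; rewrite subnn => /(_ isT) bE.
have : padd (nth p0 L 0) (epsn e') \in rcons x0 p ++ mid L k k b ++ x1.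
  by rewrite -pE mem_cat mem_rcons inE eqxx.
move: bE; rewrite /bc => -[h0 h1 h2 h3].
have -> : (padd (nth p0 L 0) (epsn e') \in rcons x0 p ++ mid L k k b ++ x1) =
    (padd (nth p0 L 0) (epsn e') \in L) by move: e' {pE}; apply: ord4_case.
rewrite -pE => /sL pL; have [_ _ _ + _] := Cx.
by rewrite cat_uniq => /and3P[_ /hasPn/(_ _ pL)]; rewrite /= mem_rcons inE eqxx.
Qed.

Lemma mid_rev L k a b : a <= k -> k + b < size L ->
  mid (rev L) (size L - k.+1) b a = rev (mid L k a b).
Proof.
move=> ak bk; have s1 := size_mid ak bk.
have ak' : b <= size L - k.+1 by lia.
have bk' : size L - k.+1 + a < size (rev L) by rewrite size_rev; lia.
have s2 := size_mid ak' bk'.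
apply: (@eq_from_nth _ p0); first by rewrite size_rev s1 s2 addnC.
move=> m; rewrite s2 ltnS => hm.
rewrite nth_mid // nth_rev; last lia.
rewrite nth_rev ?s1; last lia.
rewrite nth_mid //; last lia.
by rewrite (_ : size L - _ = k - a + ((a + b).+1 - m.+1)) //; lia.
Qed.

Lemma ext_rev L k a b x0 x1 : a <= k -> k + b < size L -> ext L k a b x0 x1 ->
  rev (x0 ++ mid L k a b ++ x1) =
    rev x1 ++ mid (rev L) (size L - k.+1) b a ++ rev x0 /\
  ext (rev L) (size L - k.+1) b a (rev x1) (rev x0).
Proof.
move=> ak bk [Cx hx].
have e : rev (x0 ++ mid L k a b ++ x1) =
    rev x1 ++ mid (rev L) (size L - k.+1) b a ++ rev x0.
  by rewrite mid_rev // !rev_cat -catA.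
split=> //; split; rewrite -e.
  have := config_rev Cx; rewrite !size_cat size_mid // size_rev.
  by rewrite (_ : _ - _ = size x1 + b) //; lia.
move=> c hc; rewrite nth_rev; last lia.
rewrite (@bc_mem _ (x0 ++ mid L k a b ++ x1)); last by move=> z; rewrite mem_rev.
rewrite (@bc_mem (rev L) L); last by move=> z; rewrite mem_rev.
by apply: hx; lia.
Qed.

Lemma ext_rev' L k a b x0 x1 : a <= k -> k + b < size L ->
  ext (rev L) (size L - k.+1) b a x1 x0 -> ext L k a b (rev x0) (rev x1).
Proof.
move=> ak bk h.
have ak' : b <= size L - k.+1 by lia.
have bk' : size L - k.+1 + a < size (rev L) by rewrite size_rev; lia.
have [_] := ext_rev ak' bk' h.
by rewrite revK size_rev (_ : size L - (size L - k.+1).+1 = k) //; lia.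
Qed.

(** * Shrinking the interval *)

Section Lower.

Variables (A : automaton) (T : nat).
Hypothesis solA : solution A.

Definition fires L k a b x0 x1 : Prop := fires_at A (x0 ++ mid L k a b ++ x1) T.

Definition nonint L k a b : Prop := forall x0 y1 y0 x1,
  ext L k a b x0 y1 -> ext L k a b y0 x1 -> ext L k a b x0 x1.

(** The right component alone settles the firing time; the existence clause keeps the universal one
    from being vacuous. *)
Definition forced L k a b : Prop := exists x1,
  (exists x0, ext L k a b x0 x1) /\
  forall x0, ext L k a b x0 x1 -> fires L k a b x0 x1.

(* The last node of some [x1] cannot know at time [T] what precedes [p_(-a)], because news from
   there take time [(a + 1) + (a + 1 + b + size x1)]. *)
Definition unseen L k a b : Prop :=
  a = k \/ exists x0 x1, ext L k a b x0 x1 /\ T < 2 * a + b + size x1 + 2.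

Definition inv L k a b : Prop :=
  [/\ forced L k a b, forced (rev L) (size L - k.+1) b a,
      unseen L k a b & unseen (rev L) (size L - k.+1) b a].

Section At.

Variables (L : seq pos) (k a b : nat).
Hypotheses (C : is_config L k) (ak : a <= k) (bk : k + b < size L).

(** By [run_suffix], the last node of the common suffix behaves identically in both configurations
    up to time [T]. *)
Lemma fires_other x0 z0 x1 : ext L k a b x0 x1 -> ext L k a b z0 x1 ->
  T < 2 * a + b + size x1 + 2 -> fires L k a b x0 x1 -> fires L k a b z0 x1.
Proof.
move=> [Cx hx] [Cz hz] hT.
have sD : size (mid L k a b ++ x1) = (a + b + size x1).+1.
  by rewrite size_cat size_mid.
have hn : a + b + size x1 < size (mid L k a b ++ x1) by rewrite sD.
have qm y : nth p0 (mid L k a b ++ x1) (a + b + size x1) \in y ++ mid L k a b ++ x1.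
  by rewrite mem_cat mem_nth ?orbT.
apply: (fires_transfer (solA Cz) (qm x0) (qm z0)) => t tT.
apply: (@run_suffix A _ a) => //; first by rewrite sD; lia.
  by apply: leq_trans (leq_ltn_trans tT hT) _; lia.
rewrite nth_cat size_mid // nth_mid // addn0 hx ?hz //; lia.
Qed.

(** Join the left component of the mirrored hypothesis to the long [x1] of [unseen]. The result
    fires at [T], and the end of [x1] cannot tell this left component from any other. *)
Lemma forced_left : nonint L k a b -> forced (rev L) (size L - k.+1) b a ->
  unseen L k a b -> forced L k a b.
Proof.
move=> ni [x0' [[y1' hy] fy]] un; set x0 := rev x0'; set y1 := rev y1'.
have w : ext L k a b x0 y1 by apply: ext_rev'.
have {}fy z1 : ext L k a b x0 z1 -> fires L k a b x0 z1.
  move=> h; have [e hr] := ext_rev ak bk h.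
  have := fy (rev z1); rewrite /fires -[x0']revK -/x0 -e => /(_ hr).
  by apply: fires_mem => z; rewrite mem_rev.
case: un => [ek|[z0 [x1 [hx hT]]]]; last first.
  exists x1; split; first by exists z0.
  move=> v0 hv; have h := ni _ _ _ _ w hx.
  by apply: (fires_other h hv hT); apply: fy.
(* For [a = k] only the empty left component is possible: noninterference pairs [v0] with the right
   part of [L] itself, so that [end_nil] applies. *)
have nil0 v0 v1 : ext L k a b v0 v1 -> v0 = [::].
  move=> h; have := ni _ _ _ _ h (ext_self C ak bk).
  rewrite ek; apply: end_nil => //; move=> z.
  by rewrite {1}(mid_split (leqnn k) bk) subnn take0.
exists y1; split; first by exists x0.
by move=> v0 h; rewrite (nil0 _ _ h) -(nil0 _ _ w); apply: fy.
Qed.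

End At.

Lemma rev_hyps L k a b : is_config L k -> a <= k -> k + b < size L ->
  [/\ is_config (rev L) (size L - k.+1), b <= size L - k.+1,
      size L - k.+1 + a < size (rev L) & size (rev L) - (size L - k.+1).+1 = k].
Proof. by move=> C ak bk; rewrite size_rev; split; [exact: config_rev|lia|lia|lia]. Qed.

Lemma nonint_rev L k a b : a <= k -> k + b < size L -> nonint L k a b ->
  nonint (rev L) (size L - k.+1) b a.
Proof.
move=> ak bk ni x0 y1 y0 x1 /(ext_rev' ak bk) h1 /(ext_rev' ak bk) h2.
by have [_] := ext_rev ak bk (ni _ _ _ _ h2 h1); rewrite !revK.
Qed.

Lemma inv_rev L k a b : is_config L k -> a <= k -> k + b < size L -> inv L k a b ->
  inv (rev L) (size L - k.+1) b a.
Proof.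
move=> C ak bk [h1 h2 h3 h4]; have [_ _ _ e] := rev_hyps C ak bk.
by split; rewrite ?e ?revK.
Qed.

(** Joined to the forced left component, the long [x1] gives a configuration that fires at [T]. Its
    last node is blind even to what precedes [p_(-a+1)], so the interval can give up [p_(-a)]. *)
Lemma inv_step L k a b x0 x1 : is_config L k -> a <= k -> k + b < size L ->
  nonint L k a b -> inv L k a b -> ext L k a b x0 x1 -> T < 2 * a + b + size x1 ->
  0 < a /\ (nonint L k a.-1 b -> inv L k a.-1 b).
Proof.
move=> C ak bk ni [h1 h2 h3 h4] hx hT.
have [C' ak' bk' kk] := rev_hyps C ak bk.
have [v0 fv] : exists v0, ext L k a b v0 x1 /\ fires L k a b v0 x1.
  case: h2 => v0' [[v1' hv] fv]; exists (rev v0').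
  have h := ni _ _ _ _ (ext_rev' ak bk hv) hx; split=> //.
  have [e hr] := ext_rev ak bk h.
  move: (fv (rev x1)); rewrite -{1}[v0']revK => /(_ hr); rewrite /fires -{1}[v0']revK -e.
  by apply: fires_mem => z; rewrite mem_rev.
case: fv => hv fv.
(* For [a = 0] the last node is farther than [T] from the general and cannot fire at [T]. *)
have a0 : 0 < a.
  case: (posnP a) => // a0; have [Cv _] := hv.
  have sz : size (v0 ++ mid L k a b ++ x1) = size v0 + ((a + b).+1 + size x1).
    by rewrite !size_cat size_mid.
  have hl : size v0 + (a + b + size x1) < size (v0 ++ mid L k a b ++ x1) by rewrite sz; lia.
  by have := fires_dist Cv hl fv; rewrite /dist; lia.
split=> // ni'; have ak1 : a.-1 <= k by lia.
have [C1 ak1' bk1' _] := rev_hyps C ak1 bk.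
have [hv' ev'] := ext_left ak bk a0 hv.
have un : unseen L k a.-1 b.
  by right; exists (rcons v0 (nth p0 L (k - a))), x1; split=> //; lia.
have fo : forced L k a.-1 b.
  exists x1; split; first by exists (rcons v0 (nth p0 L (k - a))).
  move=> z0 hz; apply: (fires_other ak1 bk hv' hz); first lia.
  by rewrite /fires ev'.
(* Moving [p_(-a)] into the left component lowers [a] and raises the length by one, so the mirrored
   bound is unchanged. *)
have un' : unseen (rev L) (size L - k.+1) b a.-1.
  case: h4 => [e|[w1 [w0 [hw hTw]]]]; first by left.
  right; have hw' := ext_rev' ak bk hw.
  have [hl _] := ext_left ak bk a0 hw'.
  have [_ hr] := ext_rev ak1 bk hl.
  by do 2!eexists; split; first exact: hr; rewrite size_rev size_rcons size_rev; lia.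
split=> //; apply: (forced_left C1 ak1' bk1') => //; first exact: nonint_rev.
by rewrite kk revK.
Qed.

(** Any [x0] can be joined to the forced right component. The result fires at [T], so none of its
    nodes is farther than [T] from the general. *)
Lemma inv_bounded L k a b x0 x1 : is_config L k -> a <= k -> k + b < size L ->
  nonint L k a b -> inv L k a b -> ext L k a b x0 x1 -> size x0 <= T.
Proof.
move=> C ak bk ni [[v1 [[v0 hv] fv]] _ _ _] hx.
have h := ni _ _ _ _ hx hv; have := fv _ h.
have [Cx _] := h => fx.
have hl : 0 < size (x0 ++ mid L k a b ++ v1) by rewrite !size_cat size_mid //; lia.
by have := fires_dist Cx hl fx; rewrite /dist; lia.
Qed.

(** Here [fin] stands for finiteness of [W]. At a finite interval the formula exceeds [T], so one
    end moves inwards and [a + b] drops; at the first infinite one, unbounded components contradict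
    [inv_bounded]. Noninterference is required only at finite intervals and at those one step inside
    a finite one. *)
Lemma no_fire L k (fin : nat -> nat -> Prop) : is_config L k ->
  fin k (size L - k.+1) ->
  (forall a b, a <= k -> k + b < size L -> fin a b -> exists x0 x1, ext L k a b x0 x1 /\
     (T < 2 * a + b + size x1 \/ T < 2 * b + a + size x0)) ->
  (forall a b, a <= k -> k + b < size L -> ~ fin a b -> exists x0 x1, ext L k a b x0 x1 /\
     (T < size x1 \/ T < size x0)) ->
  (forall a b, a <= k -> k + b < size L ->
     [\/ fin a b, a < k /\ fin a.+1 b | k + b.+1 < size L /\ fin a b.+1] ->
     nonint L k a b) ->
  ~ fires_at A L T.
Proof.
move=> C fin0 big inf ni fL; have kL : k < size L by case: C.
have step a b : a <= k -> k + b < size L -> inv L k a b -> nonint L k a b -> fin a b -> False.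
  move eN : (a + b) => N; elim/ltn_ind: N a b eN => N IH a b eN ak bk iv nab fab.
  have [C' ak' bk' kk] := rev_hyps C ak bk.
  have next a' b' : a' + b' < N -> a' <= k -> k + b' < size L -> inv L k a' b' ->
      nonint L k a' b' -> False.
    move=> lt ak1 bk1 iv1 n1; case: (Classical_Prop.classic (fin a' b')) => [f1|nf].
      exact: (IH _ lt a' b').
    have [x0 [x1 [hx hT]]] := inf a' b' ak1 bk1 nf.
    case: hT; last by rewrite ltnNge (inv_bounded C ak1 bk1 n1 iv1 hx).
    have [C2 ak2 bk2 kk2] := rev_hyps C ak1 bk1.
    have [_ hr] := ext_rev ak1 bk1 hx.
    have := inv_bounded C2 ak2 bk2 (nonint_rev ak1 bk1 n1) (inv_rev C ak1 bk1 iv1) hr.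
    by rewrite size_rev ltnNge => ->.
  have [x0 [x1 [hx [hT|hT]]]] := big a b ak bk fab.
    have [a0 hi] := inv_step C ak bk nab iv hx hT.
    have n1 : nonint L k a.-1 b.
      apply: ni; [lia|lia|constructor 2; split; first lia].
      by rewrite prednK.
    by apply: (next a.-1 b) => //; [lia|lia|exact: hi].
  have [_ hr] := ext_rev ak bk hx.
  have [|b0 hi] := inv_step C' ak' bk' (nonint_rev ak bk nab) (inv_rev C ak bk iv) hr.
    by rewrite size_rev.
  have bk1 : k + b.-1 < size L by lia.
  have n1 : nonint L k a b.-1.
    apply: ni => //; constructor 3; rewrite prednK //.
  apply: (next a b.-1) => //; first lia.
  have [C2 ak2 bk2 kk2] := rev_hyps C ak bk1.
  have := inv_rev C2 ak2 bk2 (hi (nonint_rev ak bk1 n1)).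
  by rewrite kk2 revK.
have bk : k + (size L - k.+1) < size L by lia.
have n0 : nonint L k k (size L - k.+1) by apply: ni => //; constructor 1.
have hs : ext L k k (size L - k.+1) [::] [::].
  have := ext_self C (leqnn k) bk; rewrite subnn take0 drop_oversize //; lia.
have eL : [::] ++ mid L k k (size L - k.+1) ++ [::] = L.
  have := mid_split (leqnn k) bk; rewrite subnn take0 (drop_oversize (s := L)) //; lia.
apply: (step k (size L - k.+1)) => //.
have [C' ak' bk' kk] := rev_hyps C (leqnn k) bk.
have un : unseen L k k (size L - k.+1) by left.
have un' : unseen (rev L) (size L - k.+1) (size L - k.+1) k by left.
(* The walk starts at [[r, s]]: with an empty right component [x0] is empty too, and [L] itself
   fires at [T] by assumption. *)
have fo : forced L k k (size L - k.+1).
  exists [::]; split; first by exists [::].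
  move=> x0 /(end_nil bk) ->; first by rewrite /fires eL.
  by move=> z; rewrite -{1}eL.
split=> //; apply: (forced_left C' ak' bk') => //; first exact: nonint_rev.
by rewrite kk revK.
Qed.

End Lower.

(** * Synchronization of an oriented line *)

(* One travelling direction of a cell: a signal of speed 1, and a signal of speed 1/3 in its
   first, second or third time step in the cell. *)
Definition halfcell := (bool * bool * bool * bool)%type.
Definition fast (h : halfcell) := h.1.1.1.
Definition slow1 (h : halfcell) := h.1.1.2.
Definition slow2 (h : halfcell) := h.1.2.
Definition slow3 (h : halfcell) := h.2.
Definition nohalf : halfcell := (false, false, false, false).

(* [inl (hr, hl)] is a cell with its right- and left-moving signals; [inr 0] is a wall,
   [inr 1] a wall in its first time step, [inr 2] the firing state, [inr 3] the token. *)
Definition line_st := (halfcell * halfcell + 'I_4)%type.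
Definition blank : line_st := inl (nohalf, nohalf).
Definition wall : line_st := inr (@Ordinal 4 0 isT).
Definition newwall : line_st := inr (@Ordinal 4 1 isT).
Definition fire : line_st := inr (@Ordinal 4 2 isT).
Definition token : line_st := inr (@Ordinal 4 3 isT).

Definition iswall (s : line_st) : bool := (s == wall) || (s == newwall).
Definition wallo (s : option line_st) : bool := if s is Some s then iswall s else true.
Definition isnew (s : option line_st) : bool := s == Some newwall.

(* A fast signal that meets a slow one in its second step is absorbed there. *)
Definition sent (h back : halfcell) : halfcell :=
  (fast h && ~~ slow2 back, slow1 h, slow2 h, slow3 h).
Definition rhalf (s : option line_st) : halfcell :=
  if s is Some (inl c) then sent c.1 c.2 else nohalf.
Definition lhalf (s : option line_st) : halfcell :=
  if s is Some (inl c) then sent c.2 c.1 else nohalf.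

(** The first case is a meeting inside one cell, the middle of a segment of even length. The other
    two are a meeting across an edge, seen from the cell of the slow and from that of the fast
    signal: at odd length both middle cells become walls. *)
Definition meet (behind own ownback aheadback : halfcell) : bool :=
  [|| slow2 own && fast ownback, slow3 own && fast aheadback
    | fast ownback && slow3 behind].

(** A new wall emits both signals. A fast signal that faces a wall stays one more step in its cell,
    with its direction reversed. *)
Definition moved (new wl : bool) (behind own ownback : halfcell) : halfcell :=
  ([|| new, fast behind | wl && fast ownback], new || slow3 behind, slow1 own, slow2 own).

(** The border counts as a wall. A wall between walls fires; as all segments have equal length, this
    situation arises everywhere at the same time. *)
Definition line_step (l : option line_st) (c : line_st) (r : option line_st) : line_st :=
  match c with
  | inl (hr, hl) =>
      if meet (rhalf l) hr hl (lhalf r) || meet (lhalf r) hl hr (rhalf l) then newwall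
      else inl (moved (isnew l) (wallo l) (rhalf l) hr hl,
                moved (isnew r) (wallo r) (lhalf r) hl hr)
  | inr m =>
      if c == fire then fire
      else if c == token then (if l is None then wall else blank)
      else if wallo l && wallo r then fire else wall
  end.

Definition mir (s : line_st) : line_st := if s is inl (hr, hl) then inl (hl, hr) else s.

Lemma mirK : involutive mir.
Proof. by case=> [[]|]. Qed.

Lemma iswall_mir s : iswall (mir s) = iswall s.
Proof. by case: s => [[]|]. Qed.

Lemma line_step_mir l c r :
  line_step (Some (mir r)) (mir c) (Some (mir l)) = mir (line_step (Some l) c (Some r)).
Proof.
have rm s : rhalf (Some (mir s)) = lhalf (Some s) by case: s => [[]|].
have lm s : lhalf (Some (mir s)) = rhalf (Some s) by case: s => [[]|].
have nm s : isnew (Some (mir s)) = isnew (Some s) by case: s => [[]|].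
have wm s : wallo (Some (mir s)) = wallo (Some s) by rewrite /= iswall_mir.
case: c => [[hr hl]|m].
  rewrite (_ : mir (inl (hr, hl)) = inl (hl, hr)) // /line_step !(rm, lm, nm, wm).
  by rewrite orbC; case: ifP.
rewrite (_ : mir (inr m) = inr m) // /line_step !wm.
by rewrite [wallo (Some r) && _]andbC; do 3?case: ifP.
Qed.

Lemma cell_eq (a b c d a' b' c' d' x y z t x' y' z' t' : bool) :
  a = a' -> b = b' -> c = c' -> d = d' -> x = x' -> y = y' -> z = z' -> t = t' ->
  inl (a, b, c, d, (x, y, z, t)) = inl (a', b', c', d', (x', y', z', t')) :> line_st.
Proof. by do 8!move=> ->. Qed.

(* The time from the start of a segment of [n] edges to its splitting: a signal of speed 1 that
   bounces off the far wall meets there the signal of speed 1/3. *)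
Definition span (n : nat) : nat := if odd n then (3 * n./2).+1 else 3 * n./2.

(** * One segment until its splitting *)

Section Segment.

Variables (v : nat -> nat -> line_st) (n : nat).
Hypothesis n2 : 1 < n.
Hypothesis vin : forall t x, 0 < x < n ->
  v t.+1 x = line_step (Some (v t x.-1)) (v t x) (Some (v t x.+1)).
(** The end cells obey only this kind of rule, because their outer neighbours belong to other
    segments. *)
Hypothesis vl : forall t, iswall (v t 0) -> ~~ iswall (v t 1) -> v t.+1 0 = wall.
Hypothesis vr : forall t, iswall (v t n) -> ~~ iswall (v t n.-1) -> v t.+1 n = wall.

(** Closed form of the space-time diagram: the fast signal is in cell [x] at time [x], the slow one
    at times [3x - 2] to [3x], and the fast one is back at time [2n - 1 - x] after bouncing off the
    wall [n]. *)
Definition busy (t x : nat) : line_st :=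
  inl ((t == x, t + 2 == 3 * x, t + 1 == 3 * x, t == 3 * x),
       (t + x + 1 == 2 * n, false, false, false)).

Definition seg_at (t x : nat) : line_st :=
  if x == 0 then (if t == 0 then newwall else wall)
  else if x == n then wall else busy t x.

Hypothesis v0 : forall x, x <= n -> v 0 x = seg_at 0 x.

Lemma rhalf_seg t x : x <= n -> rhalf (Some (seg_at t x)) =
  if (x == 0) || (x == n) then nohalf
  else (t == x, t + 2 == 3 * x, t + 1 == 3 * x, t == 3 * x).
Proof.
by rewrite -[t == x]andbT /seg_at; case: (x == 0) => /=; [case: (t == 0)|case: (x == n)].
Qed.

Lemma lhalf_seg t x : x <= n -> lhalf (Some (seg_at t x)) =
  if (x == 0) || (x == n) then nohalf else ((t + x + 1 == 2 * n) && (t + 1 != 3 * x), false, false, false).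
Proof.
by rewrite /seg_at; case: (x == 0) => /=; [case: (t == 0)|case: (x == n)].
Qed.

Lemma isnew_seg t x : isnew (Some (seg_at t x)) = (x == 0) && (t == 0).
Proof.
by rewrite /seg_at; case: (x == 0) => /=; [case: (t == 0)|case: (x == n)].
Qed.

Lemma wall_seg t x : iswall (seg_at t x) = (x == 0) || (x == n).
Proof.
by rewrite /seg_at; case: (x == 0) => /=; [case: (t == 0)|case: (x == n)].
Qed.

Lemma seg_step t x : 0 < x < n -> t < span n ->
  line_step (Some (seg_at t x.-1)) (seg_at t x) (Some (seg_at t x.+1)) =
  if (t.+1 == span n) && ((x == n./2) || (x == uphalf n)) then newwall
  else if t.+1 == span n then blank else seg_at t.+1 x.
Proof.
move=> hx ht; have nE := odd_double_half n.
have uE : uphalf n = odd n + n./2 by rewrite uphalf_half.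
rewrite {2}/seg_at; have -> : (x == 0) = false by lia.
have -> : (x == n) = false by lia.
rewrite /busy /line_step rhalf_seg; last lia.
rewrite lhalf_seg; last lia.
rewrite !isnew_seg /wallo !wall_seg.
have mE : meet (if (x.-1 == 0) || (x.-1 == n) then nohalf
     else (t == x.-1, t + 2 == 3 * x.-1, t + 1 == 3 * x.-1, t == 3 * x.-1))
    (t == x, t + 2 == 3 * x, t + 1 == 3 * x, t == 3 * x) (t + x + 1 == 2 * n, false, false, false)
    (if (x.+1 == 0) || (x.+1 == n) then nohalf else ((t + x.+1 + 1 == 2 * n) && (t + 1 != 3 * x.+1), false, false, false))
  = (t.+1 == span n) && ((x == n./2) || (x == uphalf n)).
  rewrite /meet /slow2 /slow3 /fast /= uE; move: ht; rewrite /span.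
  case: (odd n) nE => /= nE ht; case: ifP => h1; case: ifP => h2 /=; apply/idP/idP; lia.
rewrite mE.
(* No slow signal moves to the left, so the mirrored meeting never occurs. *)
have -> : forall b, meet (if b then nohalf else ((t + x.+1 + 1 == 2 * n) && (t + 1 != 3 * x.+1), false, false, false))
    (t + x + 1 == 2 * n, false, false, false) (t == x, t + 2 == 3 * x, t + 1 == 3 * x, t == 3 * x)
    (if (x.-1 == 0) || (x.-1 == n) then nohalf
     else (t == x.-1, t + 2 == 3 * x.-1, t + 1 == 3 * x.-1, t == 3 * x.-1)) = false.
  by move=> b; rewrite /meet /slow2 /slow3 /fast /=; case: ifP => _ /=; rewrite !andbF.
rewrite orbF; case: (boolP ((t.+1 == span n) && _)) => // hm.
(* In the splitting step the signals end in the new walls or are absorbed, so every other cell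
   becomes blank. *)
case hs : (t.+1 == span n).
  rewrite /moved /blank /slow1 /slow2 /slow3 /fast /=; move: ht hs hm; rewrite uE /span.
  case: (odd n) nE => /= nE ht hs hm; apply: cell_eq;
    apply/negbTE/negP; try (by []); try lia; case: ifP => h1 /=; lia.
rewrite /seg_at; have -> : (x == 0) = false by lia.
have -> : (x == n) = false by lia.
move: ht hs hm; rewrite uE /span /busy /moved /slow1 /slow2 /slow3 /fast /=.
case: (odd n) nE => /= nE ht hs hm; apply: cell_eq;
  try (by []); apply/idP/idP; try lia; case: ifP => h1 /=; lia.
Qed.

Lemma seg_run t : t < span n -> forall x, x <= n -> v t x = seg_at t x.
Proof.
elim: t => [_|t IH ht] x hx; first exact: v0.
have {}IH := IH (ltnW ht).
have [x0|x0] := posnP x.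
  rewrite x0 vl ?IH ?wall_seg //; lia.
have [xn|xn] := eqVneq x n.
  rewrite xn vr ?IH ?wall_seg ?eqxx ?orbT //; try lia.
  by rewrite /seg_at eqxx; case: eqP => //; lia.
rewrite vin ?IH ?seg_step; try lia.
by rewrite (_ : _ == span n = false) //; lia.
Qed.

Lemma seg_last x : x <= n -> v (span n) x =
  if (x == 0) || (x == n) then wall
  else if (x == n./2) || (x == uphalf n) then newwall else blank.
Proof.
move=> hx; have nE := odd_double_half n.
have [t tE] : exists t, span n = t.+1.
  by exists (span n).-1; rewrite /span; case: (odd n) nE => /=; lia.
have ht : t < span n by rewrite tE.
have IH := seg_run ht.
rewrite tE; have [x0|x0] := posnP x.
  rewrite x0 vl ?IH ?wall_seg //; lia.
have [xn|xn] := eqVneq x n.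
  rewrite xn vr ?IH ?wall_seg ?eqxx ?orbT //; lia.
rewrite vin ?IH ?seg_step; try lia.
by rewrite tE eqxx /=; case: ifP.
Qed.

Lemma seg_nofire t x : t <= span n -> x <= n -> v t x != fire.
Proof.
rewrite leq_eqVlt => /orP[/eqP->|ht] hx.
  by rewrite seg_last //; do 2?case: ifP.
by rewrite seg_run // /seg_at; do 3?case: ifP.
Qed.

End Segment.

Definition good (w : nat -> line_st) (n : nat) : Prop :=
  (w 0 = newwall /\ w n = wall \/ w 0 = wall /\ w n = newwall) /\
  forall x, 0 < x < n -> w x = blank.

Lemma seg_at0 n x : 0 < x < n -> seg_at n 0 x = blank.
Proof.
by move=> hx; rewrite /seg_at /blank /busy; do 2?[case: ifP; first lia]; move=> _ _;
  apply: cell_eq => //; lia.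
Qed.

Lemma segment_split (v : nat -> nat -> line_st) n : 1 < n ->
  (forall t x, 0 < x < n ->
     v t.+1 x = line_step (Some (v t x.-1)) (v t x) (Some (v t x.+1))) ->
  (forall t, iswall (v t 0) -> ~~ iswall (v t 1) -> v t.+1 0 = wall) ->
  (forall t, iswall (v t n) -> ~~ iswall (v t n.-1) -> v t.+1 n = wall) ->
  good (v 0) n ->
  (forall t x, t <= span n -> x <= n -> v t x != fire) /\
  (forall x, x <= n -> v (span n) x =
     if (x == 0) || (x == n) then wall
     else if (x == n./2) || (x == uphalf n) then newwall else blank).
Proof.
move=> n2 vin vl vr [[] [a0 an] hb].
  have v0 x : x <= n -> v 0 x = seg_at n 0 x.
    move=> hx; have [->|x0] := posnP x; first by rewrite a0.
    have [->|xn] := eqVneq x n.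
      by rewrite an /seg_at (gtn_eqF (ltnW n2)) !eqxx.
    by rewrite hb ?seg_at0 //; lia.
  by split=> *; [apply: (seg_nofire n2 vin)|apply: (seg_last n2 vin)].
(* A new wall on the right is reduced to one on the left by reflecting the cells and their order. *)
pose w t x := mir (v t (n - x)).
have win t x : 0 < x < n ->
    w t.+1 x = line_step (Some (w t x.-1)) (w t x) (Some (w t x.+1)).
  move=> hx; rewrite /w vin; last lia.
  rewrite -line_step_mir (_ : (n - x).-1 = n - x.+1); last lia.
  by rewrite (_ : (n - x).+1 = n - x.-1) //; lia.
have wl t : iswall (w t 0) -> ~~ iswall (w t 1) -> w t.+1 0 = wall.
  by rewrite /w !iswall_mir subn0 subn1 => h1 h2; rewrite vr.
have wr t : iswall (w t n) -> ~~ iswall (w t n.-1) -> w t.+1 n = wall.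
  rewrite /w !iswall_mir subnn (_ : n - n.-1 = 1); last lia.
  by move=> h1 h2; rewrite vl.
have w0 x : x <= n -> w 0 x = seg_at n 0 x.
  move=> hx; rewrite /w; have [->|x0] := posnP x; first by rewrite subn0 an.
  have [->|xn] := eqVneq x n.
    by rewrite subnn a0 /seg_at (gtn_eqF (ltnW n2)) !eqxx.
  by rewrite hb ?seg_at0 //; lia.
have vw t x : x <= n -> v t x = mir (w t (n - x)).
  by move=> hx; rewrite /w mirK subKn.
split=> [t x ht hx|x hx]; rewrite vw //.
  have := seg_nofire n2 win wl wr w0 ht (leq_subr x n).
  by case: (w _ _) => [[]|].
rewrite (seg_last n2 win wl wr w0) ?leq_subr //.
have -> : (n - x == 0) || (n - x == n) = (x == 0) || (x == n) by apply/idP/idP; lia.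
have -> : (n - x == n./2) || (n - x == uphalf n) = (x == n./2) || (x == uphalf n).
  by have := odd_double_half n; rewrite uphalf_half => nE; apply/idP/idP; lia.
by do 2?case: ifP.
Qed.

(** * Halving all segments at once *)

Section Line.

Variables (N : nat) (c : nat -> nat -> line_st).
Hypothesis cE : forall t x, x <= N ->
  c t.+1 x = line_step (if 0 < x then Some (c t x.-1) else None) (c t x)
                       (if x < N then Some (c t x.+1) else None).

(** All segments have the same length. They form a cover rather than a partition: the halves of a
    segment share a wall at even length and lie one edge apart at odd length. *)
Definition covered (n t : nat) : Prop :=
  forall x, x <= N -> exists a,
    [/\ a <= x <= a + n, a + n <= N & good (fun y => c t (a + y)) n].

Lemma iswall_step l m r : iswall m ->
  line_step l m r = if wallo l && wallo r then fire else wall.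
Proof. by case/orP => /eqP->. Qed.

Lemma covered_step n t : 1 < n -> covered n t ->
  covered n./2 (t + span n) /\
  forall s x, s <= span n -> x <= N -> c (t + s) x != fire.
Proof.
move=> n2 cov; have nE := odd_double_half n.
have split a : a + n <= N -> good (fun y => c t (a + y)) n ->
  (forall s x, s <= span n -> x <= n -> c (t + s) (a + x) != fire) /\
  (forall x, x <= n -> c (t + span n) (a + x) =
     if (x == 0) || (x == n) then wall
     else if (x == n./2) || (x == uphalf n) then newwall else blank).
  move=> han hg; apply: (segment_split (v := fun s x => c (t + s) (a + x)) n2) => //.
  - move=> s x hx; rewrite addnS cE; last lia.
    have [-> ->] : 0 < a + x /\ a + x < N by lia.
    by rewrite addnS (_ : (a + x).-1 = a + x.-1) //; lia.
  - move=> s; rewrite addn0 addn1 addnS => h1 h2.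
    rewrite cE; last lia.
    have h3 : a < N by lia.
    rewrite iswall_step // h3.
    by rewrite /= (negbTE h2) andbF.
  - move=> s; rewrite addnS => h1 h2.
    have h3 : 0 < a + n by lia.
    have h4 : (a + n).-1 = a + n.-1 by lia.
    by rewrite cE // iswall_step // h3 h4 /= (negbTE h2).
  by rewrite addn0.
split=> [x hx|s x hs hx]; have [a [hax han hg]] := cov x hx; have [h1 h2] := split a han hg.
  have [hl|hl] := leqP x (a + n./2).
    (* The left half gets its new wall on the right. The right half starts at [uphalf n], which for
       odd [n] is the second middle cell. *)
    exists a; split; [lia|lia|split].
      right; rewrite h2 // h2; last lia.
      by split=> //; do 2?[case: ifP; first lia]; rewrite eqxx.
    move=> y hy; rewrite h2; last lia.
    by rewrite uphalf_half; do 2?[case: ifP; first lia].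
  exists (a + uphalf n); split; rewrite ?uphalf_half; [lia|lia|split].
    left; rewrite addn0 -addnA !h2; try lia.
    split; first by do 2?[case: ifP; first lia]; rewrite uphalf_half eqxx orbT.
    by case: ifP => //; lia.
  move=> y hy; rewrite -addnA h2; last lia.
  by rewrite uphalf_half; do 2?[case: ifP; first lia].
by rewrite -(subnKC (n := x) (m := a)) ?h1 //; lia.
Qed.

(** At length 1 every cell is a wall and all fire in the next step; each earlier halving takes
    [span n] steps without firing. *)
Lemma covered_fire n t : 0 < n -> covered n t ->
  exists2 s, (forall s' x, t <= s' -> s' < s -> x <= N -> c s' x != fire) &
             (forall x, x <= N -> c s x = fire).
Proof.
elim/ltn_ind: n t => n IH t n0 cov.
have [n1|n2] := leqP n 1.
  have {}n1 : n = 1 by lia.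
  have W x : x <= N -> iswall (c t x).
    move=> hx; have [a [hax _ [h _]]] := cov x hx; move: h; rewrite addn0 n1 => h.
    have [->|->] : x = a \/ x = a + 1 by lia.
      by case: h => -[-> _].
    by case: h => -[_ ->].
  exists t.+1 => [s x h1 h2 hx|x hx].
    by rewrite (_ : s = t); [have := W _ hx; case/orP => /eqP->|lia].
  rewrite cE // iswall_step ?W //.
  have -> : wallo (if 0 < x then Some (c t x.-1) else None).
    by case: ifP => //= h; apply: W; lia.
  have -> // : wallo (if x < N then Some (c t x.+1) else None).
  by case: ifP => //= h; apply: W.
have [cov' nf] := covered_step n2 cov.
have [||s h1 h2] := IH n./2 _ _ _ cov'; try lia.
exists s => // s' x hs' hs hx.
have [hh|hh] := leqP (t + span n) s'; first exact: h1.
by rewrite -(subnKC hs') nf //; lia.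
Qed.

End Line.

(** * A solution of g-2PATH *)

Lemma pick_uniq (T : finType) (P : pred T) x :
  P x -> (forall y, P y -> y = x) -> [pick y | P y] = Some x.
Proof. by move=> Px h; case: pickP => [y /h->|/(_ x)] //; rewrite Px. Qed.

Lemma pick_none (T : finType) (P : pred T) : (forall y, ~~ P y) -> [pick y | P y] = None.
Proof. by move=> h; case: pickP => // y; rewrite (negbTE (h y)). Qed.

(* [inl None] is quiescent; [inl (Some e)] hosts the token on its way to the first end, in
   direction [e]; [inr (dl, dr, c)] is a node of the oriented line, with its left and right ports. *)
Definition squad_st := (option 'I_4 + option 'I_4 * option 'I_4 * line_st)%type.

(** Nodes that have not yet joined the line are read as blank cells, and an absent port as the
    border. *)
Definition port (d : option 'I_4) (u : 'I_4 -> option squad_st) : option line_st :=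
  obind (fun e => omap (fun s : squad_st => if s is inr o then o.2 else blank) (u e)) d.

Definition other (u : 'I_4 -> option squad_st) (e : 'I_4) : option 'I_4 :=
  [pick e' | (e' != e) && isSome (u e')].

Definition heads (v : option squad_st) (e : 'I_4) : bool :=
  if v is Some (inr (_, dr, c)) then (dr == Some e) && (c == token) else false.

Definition squad_step (s : squad_st) (u : 'I_4 -> option squad_st) : squad_st :=
  match s with
  | inr (dl, dr, c) => inr (dl, dr, line_step (port dl u) c (port dr u))
  | inl (Some _) => inl None
  | inl None =>
      match [pick e | u e == Some (inl (Some (opp e)))] with
      | Some e => if other u e is Some e' then inl (Some e') else inr (None, Some e, token)
      | None =>
          match [pick e | heads (u e) (opp e)] with
          | Some e => if other u e is Some e' then inr (Some e, Some e', token)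
                      else inr (Some e, None, newwall)
          | None => inl None
          end
      end
  end.

Definition bcat (b : bool * bool * bool * bool) (e : 'I_4) : bool :=
  nth false [:: b.1.1.1; b.1.1.2; b.1.2; b.2] e.

(** A general with a single neighbour is already an end, so the token turns round at once; a general
    without neighbours is a new wall between borders and fires in the next step. *)
Definition squad_init (b : bool * bool * bool * bool) : squad_st :=
  if [pick e | bcat b e] is Some e then
    if [pick e' | (e' != e) && bcat b e'] is Some _ then inl (Some e)
    else inr (None, Some e, token)
  else inr (None, None, newwall).

Definition squad_fire : pred squad_st := fun s => if s is inr o then o.2 == fire else false.

Lemma squad_stable a b c d :
  quiet_input (inl None : squad_st) a -> quiet_input (inl None : squad_st) b ->
  quiet_input (inl None : squad_st) c -> quiet_input (inl None : squad_st) d ->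
  squad_step (inl None) (fun4 a b c d) = inl None.
Proof.
move=> ha hb hc hd.
have h e : fun4 a b c d e = None \/ fun4 a b c d e = Some (inl None).
  have q o : quiet_input (inl None : squad_st) o -> o = None \/ o = Some (inl None).
    by case: o => [x /eqP->|]; [right|left].
  by move: e; apply: ord4_case; rewrite /fun4 /=; apply: q.
by rewrite /squad_step !pick_none // => e; case: (h e) => ->.
Qed.

Definition squad : automaton :=
  @Automaton squad_st (inl None) #|{: bool * bool * bool * bool}|
    (fun i => squad_init (enum_val i)) squad_fire (fun b => enum_rank b)
    (fun s a b c d => squad_step s (fun4 a b c d)) isT squad_stable.

Arguments line_step : simpl never.

(** * Orientation of the path by the token *)

Section Squad.

Variables (L : seq pos) (k : nat).
Hypothesis C : is_config L k.

Notation st t x := (run squad L t (nth p0 L x)).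

Lemma squad_run t x : x < size L ->
  st t.+1 x = squad_step (st t x) (nbf L (fun y => st t y) x).
Proof. by move=> hx; rewrite (run_step _ _ C) // -[in RHS](fun4E (nbf _ _ _)). Qed.

Lemma bcatE x e : x < size L ->
  bcat (bc L (nth p0 L x)) e = (padd (nth p0 L x) (epsn e) \in L).
Proof. by move=> hx; move: e; apply: ord4_case. Qed.

Lemma squad_run0 : st 0 k = squad_init (bc L p0).
Proof. by case: C => _ h0 _ _ _; rewrite h0 /= enum_rankK. Qed.

Lemma squad_run0n x : x < size L -> x != k -> st 0 x = inl None.
Proof. by move=> hx xk; rewrite /= (config_eq0 C) // (negbTE xk). Qed.

Lemma other_succ (s : nat -> squad_st) x : x.+1 < size L ->
  other (nbf L s x) (dir L x x.+1) = if 0 < x then Some (dir L x x.-1) else None.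
Proof.
move=> hx; rewrite /other; case: ifP => x0.
  apply: pick_uniq; first by rewrite (dir_neq C) // (nbf_some _ C) ?prednK ?eqxx //; lia.
  by move=> e /andP[he]; rewrite /nbf x0 (negbTE he) andbF; case: eqP.
by apply: pick_none => e; rewrite negb_and negbK /nbf x0 hx; case: eqP.
Qed.

Lemma other_pred (s : nat -> squad_st) x : 0 < x -> x < size L ->
  other (nbf L s x) (dir L x x.-1) =
  if x.+1 < size L then Some (dir L x x.+1) else None.
Proof.
move=> x0 hx; rewrite /other; case: ifP => xN.
  apply: pick_uniq; first by rewrite eq_sym (dir_neq C) // (nbf_some _ C) ?eqxx ?orbT //; lia.
  by move=> e /andP[he]; rewrite /nbf xN (negbTE he) andbF; case: eqP.
by apply: pick_none => e; rewrite negb_and negbK /nbf x0 xN; case: eqP.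
Qed.

Variable N : nat.
Hypotheses (sz : size L = N.+1) (N0 : 0 < N).
(** The token first goes towards index 0; [squad_start] provides this up to reversal of the list. *)
Hypothesis start : st 0 k =
  if k == 0 then inr (None, Some (dir L 0 1), token) else inl (Some (dir L k k.-1)).

Definition going (t x : nat) : squad_st :=
  if x == k - t then
    if x == 0 then inr (None, Some (dir L 0 1), token) else inl (Some (dir L x x.-1))
  else inl None.

Lemma run_going t x : t <= k -> x <= N -> st t x = going t x.
Proof.
have kN : k <= N by case: C; rewrite sz.
elim: t x => [|t IH] x tk hx.
  rewrite /going subn0; case: eqP => [->|/eqP xk]; first exact: start.
  by rewrite squad_run0n // sz.
have xs : x < size L by rewrite sz.
rewrite squad_run // IH //; last lia.
have gE y : y < size L -> st t y = going t y by rewrite sz => hy; apply: IH; lia.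
rewrite {1}/going; case: eqP => [xk|xk].
  rewrite [x == 0](_ : _ = false); last lia.
  by rewrite /going (_ : x == k - t.+1 = false) //; lia.
rewrite /squad_step /going; case: eqP => xk'.
  have x1 : x.+1 < size L by rewrite sz; lia.
  have uE : nbf L (fun y => st t y) x (dir L x x.+1) = Some (inl (Some (opp (dir L x x.+1)))).
    rewrite (nbf_some _ C) ?eqxx ?orbT // gE // /going (_ : x.+1 == k - t); last lia.
    by rewrite (dir_opp C) ?eqxx ?orbT.
  rewrite (@pick_uniq _ _ (dir L x x.+1)) ?uE //.
    by rewrite other_succ //; case: posnP => // ->.
  move=> e /eqP /(nbfP xs)[y [hy hxy -> he]].
  move: he; rewrite gE // /going; case: eqP => // hy' _.
  by congr (dir L x _); lia.
rewrite !pick_none // => e; apply/negP.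
  case E : nbf => [v|//]; case: (nbfP xs E) => y [hy hxy _ ->].
  by rewrite gE // /going; case: eqP => // hy'; rewrite (_ : y == 0 = false) //; lia.
(* The only node left next to the token is the one behind it, and the token points the other way. *)
move=> /eqP /(nbfP xs)[y [hy hxy ee he]].
move: he; rewrite gE // /going; case: eqP => // hy'.
rewrite (_ : y == 0 = false); last lia.
move=> [/esym]; rewrite ee (dir_opp C) // => h.
have xy : x = y.+1 by lia.
have : dir L y y.-1 != dir L y y.+1 by apply: (dir_neq C); [lia|rewrite sz; lia].
by rewrite -xy h eqxx.
Qed.

Definition ori (x : nat) : option 'I_4 * option 'I_4 :=
  (if 0 < x then Some (dir L x x.-1) else None,
   if x < N then Some (dir L x x.+1) else None).

(** The state at time [k + y]: the token, on its way from 0 to [N], is at [y], and the nodes behind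
    it are oriented. *)
Definition coming (y x : nat) : squad_st :=
  if x < y then inr (ori x, if x == 0 then wall else blank)
  else if x == y then inr (ori x, if y == N then newwall else token)
  else inl None.

Lemma line_blank l r : isnew (Some l) = false -> isnew (Some r) = false ->
  rhalf (Some l) = nohalf -> lhalf (Some r) = nohalf ->
  line_step (Some l) blank (Some r) = blank.
Proof. by rewrite /line_step /blank => -> -> -> -> /=; rewrite /moved /= !andbF. Qed.

Lemma run_coming y x : y <= N -> x <= N -> st (k + y) x = coming y x.
Proof.
elim: y x => [|y IH] x yN hx.
  rewrite addn0 run_going // /going /coming subnn /ori.
  by case: eqP => // ->; rewrite (_ : 0 == N = false) ?N0 //; lia.
have xs : x < size L by rewrite sz.
rewrite addnS squad_run // IH //; last lia.
have gE z : z < size L -> st (k + y) z = coming y z by rewrite sz => hz; apply: IH; lia.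
have yN' : (y == N) = false by lia.
rewrite {1}/coming; case: ltnP => [xy|xy].
  rewrite /squad_step /coming [ori x]surjective_pairing.
  rewrite (_ : x < y.+1) //=; last lia.
  rewrite (_ : x < N); last lia.
  rewrite /port /= (nbf_some _ C) ?eqxx ?orbT //; last by rewrite sz; lia.
  have rE : exists2 c, st (k + y) x.+1 = inr (ori x.+1, c) & c = blank \/ c = token.
    rewrite gE; last by rewrite sz; lia.
    rewrite /coming yN' /=; case: ifP => h; first by exists blank; [|left].
    by exists token; [case: eqP => //; lia|right].
  case: rE => c -> hc; rewrite /=.
  have [x0|x0] := posnP x; first by rewrite /= /line_step; case: hc => ->.
  rewrite /= (nbf_some _ C) ?prednK ?eqxx //; last by lia.
  rewrite gE; last by lia.
  rewrite /coming (_ : x.-1 < y) /=; last lia.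
  by rewrite line_blank //; [case: ifP|case: hc => ->|case: ifP|case: hc => ->].
rewrite yN'; case: eqP => [xy'|xy'].
  rewrite /squad_step /coming [ori x]surjective_pairing.
  rewrite (_ : x < y.+1) //=; last lia.
  have [x0|x0] := posnP x; first by rewrite /=.
  by rewrite /port /= (nbf_some _ C) ?prednK ?eqxx //; lia.
rewrite /squad_step; case: pickP => [e /eqP /(nbfP xs)[z [hz hxz _]]|_].
  by rewrite gE // /coming; case: ifP => // _; case: ifP.
rewrite /coming (_ : x < y.+1 = false); last lia.
have tok z e : z < size L -> heads (Some (st (k + y) z)) e -> z = y /\ Some e = (ori y).2.
  move=> hz; rewrite gE // /coming; case: ltnP => hy.
    by rewrite /=; case: (z == 0); rewrite andbF.
  by case: eqP => // -> /= /andP[/eqP-> _].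
case: eqP => xy''.
  have xz : x.-1 = y by lia.
  rewrite (@pick_uniq _ _ (dir L x x.-1)); last 2 first.
  - rewrite (nbf_some _ C) ?prednK ?eqxx //; try lia.
    rewrite xz gE; last by lia.
    rewrite /coming ltnn eqxx yN' /= (_ : y < N); last lia.
    by rewrite xy'' (dir_opp C) ?eqxx // ?sz; lia.
  - move=> e; case E : nbf => [v|//]; case: (nbfP xs E) => z [hz hxz -> ->] /tok[] // -> _.
    by rewrite xz.
  rewrite other_pred //; last by lia.
  rewrite sz ltnS /ori (_ : 0 < x); last lia.
  rewrite -xy''; case: ifP => hN; first by rewrite (_ : x == N = false) //; lia.
  by rewrite (_ : x == N) //; lia.
rewrite pick_none // => e; apply/negP; case E : nbf => [v|//].
by case: (nbfP xs E) => z [hz hxz _ ->] /tok[] //; lia.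
Qed.

Definition line_of (t x : nat) : line_st :=
  if st (k + N + t) x is inr o then o.2 else blank.

Lemma run_line t x : x <= N -> st (k + N + t) x = inr (ori x, line_of t x).
Proof.
elim: t x => [|t IH] x hx; rewrite /line_of.
  rewrite addn0 run_coming // /coming; case: ltnP => // h.
  by rewrite (_ : x == N) //; lia.
by rewrite addnS squad_run ?sz // IH // [ori x]surjective_pairing.
Qed.

Lemma line_ofE t x : x <= N -> line_of t.+1 x =
  line_step (if 0 < x then Some (line_of t x.-1) else None) (line_of t x)
            (if x < N then Some (line_of t x.+1) else None).
Proof.
move=> hx; have xs : x < size L by rewrite sz.
rewrite {1}/line_of addnS squad_run // run_line // [ori x]surjective_pairing /=.
congr line_step; case: ifP => h //=; rewrite (nbf_some _ C) ?prednK ?eqxx ?orbT ?run_line //;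
  rewrite ?sz; lia.
Qed.

Lemma squad_fires_from : exists t, fires_at squad L t.
Proof.
(* At time [k + N] the end 0 is a wall, the end [N] a new wall, and the cells between them are
   blank. *)
have cov : covered N line_of N 0.
  move=> x hx; exists 0; split; rewrite ?addn0 //; split.
    right; rewrite /line_of !addn0 add0n !run_coming // /coming N0 ltnn eqxx.
    by rewrite eqxx.
  move=> y hy; rewrite add0n /line_of addn0 run_coming //; last lia.
  rewrite /coming (_ : y < N) /=; last lia.
  by rewrite (_ : y == 0 = false) //; lia.
have [s h1 h2] := covered_fire line_ofE N0 cov.
exists (k + N + s); split=> [t ht q /(nthP p0)[x]|q /(nthP p0)[x]]; rewrite sz ltnS => hx <-.
  have [hk|hk] := leqP (k + N) t.
    rewrite -(subnKC hk) run_line //=; apply: h1 => //; lia.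
  have [hk'|hk'] := leqP k t.
    rewrite -(subnKC hk') run_coming //; last lia.
    by rewrite /coming; do 4?case: ifP.
  rewrite run_going //; last lia.
  by rewrite /going; do 2?case: ifP.
by rewrite run_line //= h2.
Qed.

End Squad.

(** A general with two neighbours picks one of them; if this is the successor, reversing the list
    makes it the predecessor. *)
Lemma squad_start L k N : is_config L k -> size L = N.+1 -> 0 < N ->
  let start L k := run squad L 0 (nth p0 L k) =
    if k == 0 then inr (None, Some (dir L 0 1), token) else inl (Some (dir L k k.-1)) in
  start L k \/ start (rev L) (size L - k.+1).
Proof.
move=> C sz N0 start; have [hk h0 _ uL _] := C.
have Cr := config_rev C.
have inE e : bcat (bc L p0) e = (padd p0 (epsn e) \in L) by rewrite -h0 bcatE.
have r0 : run squad L 0 p0 = squad_init (bc L p0) by rewrite -(squad_run0 C) h0.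
have startr : start (rev L) (size L - k.+1) <-> run squad L 0 p0 =
    if k == N then inr (None, Some (dir L k k.-1), token) else inl (Some (dir L k k.+1)).
  rewrite /start; have [_ -> _ _ _] := Cr.
  rewrite (@run_mem _ _ L); last by move=> z; rewrite mem_rev.
  rewrite (_ : size L - k.+1 == 0 = (k == N)); last by apply/idP/idP; lia.
  case: eqP => kN.
    rewrite (_ : dir (rev L) 0 1 = dir L k k.-1) //.
    symmetry; apply: (dir_uniq Cr); rewrite ?size_rev; try lia.
    rewrite !nth_rev; try lia.
    rewrite (_ : size L - 1 = k); last lia.
    by rewrite (dir_predE C); [rewrite (_ : size L - 2 = k.-1) //; lia|lia|lia].
  rewrite (_ : dir (rev L) _ _ = dir L k k.+1) //.
  symmetry; apply: (dir_uniq Cr); rewrite ?size_rev; try lia.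
  rewrite !nth_rev; try lia.
  rewrite (_ : size L - (size L - k.+1).+1 = k); last lia.
  by rewrite (dir_succE C); [rewrite (_ : _ - _ = k.+1) //; lia|lia].
rewrite startr /start h0 r0 /squad_init.
have inD e : bcat (bc L p0) e ->
    (0 < k /\ e = dir L k k.-1) \/ (k < N /\ e = dir L k k.+1).
  rewrite inE -h0 => /(config_nb C hk)[b [hb hbk eb]].
  have ee := dir_uniq C hk hb (esym eb).
  case/orP: hbk => /eqP h; [left|right]; split; try lia; rewrite ee h //.
have in1 : 0 < k -> bcat (bc L p0) (dir L k k.-1).
  by move=> k0; rewrite inE -h0 (dir_predE C) // mem_nth // (leq_ltn_trans (leq_pred k)).
have in2 : k < N -> bcat (bc L p0) (dir L k k.+1).
  by move=> kN; rewrite inE -h0 (dir_succE C) ?mem_nth // sz.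
have [kz|k0] := posnP k.
  left; rewrite (@pick_uniq _ _ (dir L k k.+1)) ?in2 //; try lia; last first.
    by move=> e /inD[[h]|[_ ->]] //; lia.
  rewrite pick_none ?kz // => e; apply/negP => /andP[h /inD[[h']|[_ ee]]]; first lia.
  by rewrite ee kz eqxx in h.
have [kz|kN] := eqVneq k N.
  right; rewrite (@pick_uniq _ _ (dir L k k.-1)) ?in1 //; last first.
    by move=> e /inD[[_ ->]|[h]] //; lia.
  rewrite pick_none // => e; apply/negP => /andP[h /inD[[_ ee]|[h' _]]]; last lia.
  by rewrite ee eqxx in h.
have {}kN : k < N by lia.
have dn : dir L k k.-1 != dir L k k.+1 by apply: (dir_neq C); lia.
case: pickP => [e /inD he|/(_ _)/negbT/negP/(_ (in2 kN))] //.
case: he => -[_ ->]; [left|right]; case: pickP => //.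
  by move/(_ (dir L k k.+1)); rewrite eq_sym dn in2.
by move/(_ (dir L k k.-1)); rewrite dn in1.
Qed.

Theorem squad_solution : solution squad.
Proof.
move=> L k C; have [hk h0 _ _ _] := C.
have [N sz] : exists N, size L = N.+1 by exists (size L).-1; rewrite prednK // (leq_ltn_trans _ hk).
have hk' := hk; rewrite sz in hk'.
have [N0|N0] := posnP N.
  exists 1; have kz : k = 0 by lia.
  have r0 : run squad L 0 (nth p0 L k) = inr (None, None, newwall).
    rewrite (squad_run0 C) /squad_init pick_none // => e.
    rewrite -h0 bcatE //; apply/negP => /(config_nb C hk)[b [hb hbk _]]; rewrite sz in hb; lia.
  split=> [[|//] _ q|q]; move=> /(nthP p0)[x hx <-]; have -> : x = k by rewrite sz in hx; lia.
    by rewrite r0.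
  by rewrite (squad_run C) // r0.
case: (squad_start C sz N0) => h; first exact: (squad_fires_from C sz N0 h).
have [|t ht] := squad_fires_from (config_rev C) _ N0 h; first by rewrite size_rev.
by exists t; apply: fires_mem ht => z; rewrite mem_rev.
Qed.

(** * Firing early on the extensions of a given segment *)

(** By induction on [M]: a new head [p] adjacent to [q] lies just before or just after [q] on the
    path. The place after [q] is taken by the next element of the chain unless [q] is alone, and
    then the path is reversed. *)
Lemma adj_chain_split L k M : is_config L k -> M != [::] -> uniq M -> {subset M <= L} ->
  (forall i, i.+1 < size M -> adj (nth p0 M i) (nth p0 M i.+1)) ->
  exists L' x0 x1, (L' = L \/ L' = rev L) /\ L' = x0 ++ M ++ x1.
Proof.
move=> C; elim: M => // p [|q M] IH _ uM sM aM.
  have pL : p \in L by apply: sM; rewrite inE.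
  by case/splitPr: pL => x0 x1; exists (x0 ++ p :: x1), x0, x1; split; [left|].
have [||||L' [x0 [x1 [hL' eL']]]] := IH.
- by [].
- by case/andP: uM.
- by move=> z hz; apply: sM; rewrite inE hz orbT.
- by move=> i hi; apply: (aM i.+1).
have [k' C'] : exists k', is_config L' k'.
  by case: hL' => ->; [exists k|exists (size L - k.+1); apply: config_rev].
have mL' : L' =i L by case: hL' => -> z; rewrite ?mem_rev.
have pL : p \in L' by rewrite mL'; apply: sM; rewrite inE eqxx.
have /nthP-/(_ p0)[b hb eb] := pL.
have hx : size x0 < size L' by rewrite eL' size_cat -[X in X < _]addn0 ltn_add2l.
have ex : nth p0 L' (size x0) = q by rewrite eL' nth_cat ltnn subnn.
have : adj (nth p0 L' b) (nth p0 L' (size x0)) by rewrite eb ex; apply: (aM 0).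
rewrite (config_adj C') // => /orP[] /eqP h; last first.
  exists L', (take b x0), x1; split=> //; rewrite eL'.
  rewrite -{1}(cat_take_drop b x0) -catA; congr cat.
  rewrite (drop_nth p0) ?h // drop_oversize ?h //=; congr cons.
  by rewrite -eb eL' nth_cat h ltnSn.
have [M0|M0] := eqVneq M [::].
  subst M; case: x1 eL' => [|r x1] eL'.
    by move: hb; rewrite eL' h !size_cat /=; lia.
  have er : r = p.
    by rewrite -eb eL' h nth_cat ltnNge leqnSn /= subSn // subnn.
  exists (rev L'), (rev x1), (rev x0); split.
    by case: hL' => ->; [right|left; rewrite revK].
  by rewrite eL' er rev_cat /= !rev_cons -!cats1 -!catA.
case: M M0 uM {IH sM aM} eL' => // r M _ /= /andP[pM _] eL'.
move: pM; rewrite -eb eL' h nth_cat ltnNge leqnSn /= subSn // subnn /=.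
by rewrite !inE eqxx orbT.
Qed.

(** * The observing automaton *)

Section Observer.

Variables (A : automaton) (T : nat) (M : seq pos) (a : nat).
Variable B : 'I_(size M) -> bool * bool * bool * bool.

(* [inl (t, id, K)]: at time [t <= T], [id] is the index in [M] of the position of the node and
   [K] the set of the indices [m] such that the node knows that [nth p0 M m] is in the
   configuration with boundary condition [B m]. *)
Definition obs_st := ('I_T.+1 * option 'I_(size M) * {set 'I_(size M)} + st A)%type.

Definition presence (S : Type) (u : 'I_4 -> option S) : bool * bool * bool * bool :=
  (isSome (u e0), isSome (u e1), isSome (u e2), isSome (u e3)).

Definition knows (v : option obs_st) : {set 'I_(size M)} :=
  if v is Some (inl x) then x.2 else set0.

Definition heard (u : 'I_4 -> option obs_st) : {set 'I_(size M)} :=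
  [set m | [exists e, m \in knows (u e)]].

Definition seen (id : option 'I_(size M)) (b : bool * bool * bool * bool) :
    {set 'I_(size M)} :=
  if id is Some m then (if b == B m then [set m] else set0) else set0.

(** Indices in [M] spread from the general: the neighbour in direction [e] has index [m], so the
    node itself lies one step back from [nth p0 M m]. *)
Definition shift_id (id : option 'I_(size M)) (e : 'I_4) : option 'I_(size M) :=
  if id is Some m then
    [pick m' : 'I_(size M) | padd (nth p0 M m') (epsn e) == nth p0 M m]
  else None.

Definition early (v : option obs_st) : bool :=
  if v is Some (inl x) then x.1.1 < T else false.

(** A neighbour that is still observing counts as quiescent, since [A] has not been started
    there. *)
Definition forget (s : obs_st) : st A := if s is inr s then s else @quiescent A.

Definition obs_step (s : obs_st) (u : 'I_4 -> option obs_st) : obs_st :=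
  match s with
  | inl (t, id, K) =>
      if t < T then inl (inord t.+1, id, K :|: heard u)
      else inr (if omap val id == Some a then @gen A (@tau A (presence u))
                else @quiescent A)
  | inr s =>
      match [pick e | early (u e)] with
      | Some e =>
          if u e is Some (inl (t, id, _)) then
            inl (inord t.+1, shift_id id e, seen (shift_id id e) (presence u) :|: heard u)
          else inr s
      | None => inr (@delta A s (omap forget (u e0)) (omap forget (u e1))
                               (omap forget (u e2)) (omap forget (u e3)))
      end
  end.

Definition obs_init (b : bool * bool * bool * bool) : obs_st :=
  inl (ord0, insub a, seen (insub a) b).

Definition obs_fire : pred obs_st :=
  fun s => match s with inl (t, _, K) => (t == T :> nat) && (K == setT)
                      | inr s => @firing A s end.

Lemma obs_stable (b c d e : option obs_st) :
  quiet_input (inr (@quiescent A) : obs_st) b -> quiet_input (inr (@quiescent A) : obs_st) c ->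
  quiet_input (inr (@quiescent A) : obs_st) d -> quiet_input (inr (@quiescent A) : obs_st) e ->
  obs_step (inr (@quiescent A)) (fun4 b c d e) = inr (@quiescent A).
Proof.
have q o : quiet_input (inr (@quiescent A) : obs_st) o ->
    ~~ early o /\ quiet_input (@quiescent A) (omap forget o).
  by case: o => [x /eqP->|] //=.
move=> /q[hb qb] /q[hc qc] /q[hd qd] /q[he qe].
rewrite /obs_step pick_none ?quiescent_stable //.
by apply: ord4_case.
Qed.

Definition observer : automaton :=
  @Automaton obs_st (inr (@quiescent A)) #|{: bool * bool * bool * bool}|
    (fun i => obs_init (enum_val i)) obs_fire (fun b => enum_rank b)
    (fun s a b c d => obs_step s (fun4 a b c d))
    (@quiescent_not_firing A) obs_stable.

Hypotheses (aM : a < size M) (Ma : nth p0 M a = p0).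

Section Config.

Variables (L : seq pos) (k : nat).
Hypothesis C : is_config L k.

Notation st t x := (run observer L t (nth p0 L x)).

Lemma obs_run t x : x < size L ->
  st t.+1 x = obs_step (st t x) (nbf L (fun y => st t y) x).
Proof. by move=> hx; rewrite (run_step _ _ C) // -[in RHS](fun4E (nbf _ _ _)). Qed.

Lemma obs_run0 : st 0 k = obs_init (bc L p0).
Proof. by case: C => _ h0 _ _ _; rewrite h0 /= enum_rankK. Qed.

Lemma obs_quiet t x : x < size L -> t < dist x k -> st t x = inr (@quiescent A).
Proof. exact: run_quiet. Qed.

Definition sound (t x : nat) : Prop :=
  exists id K, [/\ st t x = inl (inord t, id, K),
    forall m, id = Some m -> nth p0 M m = nth p0 L x,
    x = k -> id = insub a &
    forall m, m \in K -> nth p0 M m \in L /\ bc L (nth p0 M m) = B m].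

Lemma heardP (s : nat -> obs_st) x m : x < size L ->
  reflect (exists y, [/\ y < size L, (x == y.+1) || (y == x.+1) & m \in knows (Some (s y))])
          (m \in heard (nbf L s x)).
Proof.
move=> hx; rewrite inE; apply: (iffP existsP) => [[e]|[y [hy hxy hm]]].
  case E : nbf => [v|]; last by rewrite inE.
  by case: (nbfP hx E) => y [hy hxy _ ->]; exists y.
by exists (dir L x y); rewrite (nbf_some _ C).
Qed.

Lemma presenceE (s : nat -> obs_st) x : x < size L ->
  presence (nbf L s x) = bc L (nth p0 L x).
Proof. by move=> hx; rewrite (bc_nbf s C hx). Qed.

Lemma pick_early t x : x < size L -> t < T -> dist x k = t.+1 ->
  (forall y, y < size L -> dist y k <= t -> sound t y) ->
  exists y id K, [/\ y < size L, (x == y.+1) || (y == x.+1), dist y k <= t,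
     st t y = inl (inord t, id, K) &
     st t.+1 x = inl (inord t.+1, shift_id id (dir L x y),
       seen (shift_id id (dir L x y)) (bc L (nth p0 L x)) :|:
       heard (nbf L (fun y => st t y) x))].
Proof.
rewrite /dist => hx tT hd IH.
have kL : k < size L by case: C.
rewrite obs_run // obs_quiet //; last by rewrite /dist; lia.
have tE : (inord t : 'I_T.+1) = t :> nat by rewrite inordK; lia.
rewrite /obs_step; case: pickP => [e|none].
  case E : nbf => [v|] //; case: (nbfP hx E) => y [hy hxy he hv].
  rewrite hv => ear.
  have yd : dist y k <= t.
    by rewrite leqNgt; apply/negP => h; move: ear; rewrite obs_quiet.
  have [id [K [yE _ _ _]]] := IH y hy yd.
  by exists y, id, K; split=> //; rewrite yE tE presenceE // he.
pose y := if x < k then x.+1 else x.-1.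
have hxy : (x == y.+1) || (y == x.+1) by rewrite /y; case: ifP; lia.
have hy : y < size L.
  rewrite /y; case: ifP => h; first exact: leq_ltn_trans kL.
  by rewrite (leq_ltn_trans (leq_pred x)).
have yd : dist y k <= t by rewrite /y /dist; case: ifP; lia.
have [id [K [yE _ _ _]]] := IH y hy yd.
by move: (none (dir L x y)); rewrite (nbf_some _ C) // yE /= tE tT.
Qed.

Lemma obs_sound t x : t <= T -> x < size L -> dist x k <= t -> sound t x.
Proof.
have kL : k < size L by case: C.
have h0 : nth p0 L k = p0 by case: C.
have seenP (id : option 'I_(size M)) z : z < size L ->
    (forall m, id = Some m -> nth p0 M m = nth p0 L z) ->
    forall m, m \in seen id (bc L (nth p0 L z)) ->
    nth p0 M m \in L /\ bc L (nth p0 M m) = B m.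
  move=> hz; case: id => [m'|] /=; last by move=> _ m; rewrite inE.
  move=> /(_ _ erefl) e m; case: eqP => [b|]; last by rewrite inE.
  by rewrite inE => /eqP->; rewrite e mem_nth.
elim: t x => [|t IH] x tT hx hd.
  have xk : x = k by move: hd; rewrite /dist; lia.
  rewrite /sound xk obs_run0 -{1}h0.
  exists (insub a), (seen (insub a) (bc L (nth p0 L k))); split=> //.
  - by congr (inl (_, _, _)); apply: val_inj; rewrite /= inordK.
  - by move=> m; case: insubP => // m' _ e [<-]; rewrite e Ma.
  - by apply: seenP => // m; case: insubP => // m' _ e [<-]; rewrite e Ma.
have {}IH y : y < size L -> dist y k <= t -> sound t y by apply: IH; lia.
have hK m : m \in heard (nbf L (fun y => st t y) x) ->
    nth p0 M m \in L /\ bc L (nth p0 M m) = B m.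
  case/(heardP _ _ hx) => y [hy hxy].
  have [yd|yd] := leqP (dist y k) t; last by rewrite obs_quiet // inE.
  by have [id [K [-> _ _ h]]] := IH y hy yd; apply: h.
have [xd|xd] := leqP (dist x k) t.
  have [id [K [xE h1 h2 h3]]] := IH x hx xd.
  exists id, (K :|: heard (nbf L (fun y => st t y) x)); split=> //.
    by rewrite obs_run // xE /obs_step inordK ?tT //; lia.
  by move=> m; rewrite inE => /orP[/h3|/hK].
have [||||y [id [K [hy hxy yd yE xE]]]] := @pick_early t x; try lia; try by [].
have [id' [K' [yE' h1 h2 h3]]] := IH y hy yd.
move: yE'; rewrite yE => -[eid eK]; subst id' K'.
have hid m : shift_id id (dir L x y) = Some m -> nth p0 M m = nth p0 L x.
  case: id h1 {yE h2 xE} => // m' /(_ _ erefl) e /=; case: pickP => // m'' /eqP + [<-].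
  by rewrite e (dirE C hx hy hxy) => /padd_injl.
do 2!eexists; split; first exact: xE.
- exact: hid.
- by move=> xk; move: xd; rewrite xk /dist; lia.
- by move=> m; rewrite inE => /orP[|/hK //]; apply: seenP.
Qed.

Lemma obs_nofire t q : t < T -> q \in L -> ~~ @firing observer (run observer L t q).
Proof.
move=> tT /(nthP p0)[x hx <-]; have [xd|xd] := leqP (dist x k) t.
  have [id [K [-> _ _ _]]] := obs_sound (ltnW tT) hx xd.
  by rewrite /= inordK ?(ltn_eqF tT) //; lia.
by rewrite obs_quiet //; apply: quiescent_not_firing.
Qed.

(** At time [T.+1] the node with index [a] becomes the general of [A] and all others are quiescent,
    which is the initial state of a delayed run of [A]. *)
Lemma obs_after t x : x < size L -> st (T.+1 + t) x = inr (run A L t (nth p0 L x)).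
Proof.
have kL : k < size L by case: C.
have h0 : nth p0 L k = p0 by case: C.
have TE : (inord T : 'I_T.+1) = T :> nat by rewrite inordK.
elim: t x => [|t IH] x hx; last first.
  rewrite addnS obs_run // IH // (run_step _ _ C) //.
  have fE e : omap forget (nbf L (fun y => st (T.+1 + t) y) x e) =
      nbf L (fun y => run A L t (nth p0 L y)) x e.
    rewrite /nbf; case: ifP => [/andP[x0 _]|_].
      by rewrite IH // (leq_ltn_trans (leq_pred x)).
    by case: ifP => // /andP[x1 _]; rewrite IH.
  rewrite /obs_step -!fE pick_none // => e.
  by case E : nbf => [v|] //; case: (nbfP hx E) => y [hy _ _ ->]; rewrite IH.
rewrite addn0 obs_run //; have [xd|xd] := leqP (dist x k) T.
  have [id [K [-> h1 h2 _]]] := obs_sound (leqnn T) hx xd.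
  rewrite /obs_step TE ltnn presenceE //.
  rewrite /= (config_eq0 C) //; have [xk|xk] := eqVneq x k.
    by rewrite h2 // insubT /= eqxx xk h0.
  case: eqP => // idE; case/eqP: xk; apply/eqP; rewrite -(config_eq0 C) //.
  by case: id h1 {h2} idE => [m|//] /(_ _ erefl) <- [->]; rewrite Ma.
rewrite obs_quiet // /obs_step pick_none; last first.
  move=> e; case E : nbf => [v|] //; case: (nbfP hx E) => y [hy _ _ ->].
  have [yd|yd] := leqP (dist y k) T; last by rewrite obs_quiet.
  have [id [K [-> _ _ _]]] := obs_sound (leqnn T) hy yd.
  by rewrite /= TE ltnn.
rewrite /= (config_eq0 C) // (_ : x == k = false); last by move: xd; rewrite /dist; lia.
have fq e : quiet_input (@quiescent A) (omap forget (nbf L (fun y => st T y) x e)).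
  case E : nbf => [v|] //; case: (nbfP hx E) => y [hy _ _ ->].
  have [yd|yd] := leqP (dist y k) T; last by rewrite obs_quiet /=.
  by have [id [K [-> _ _ _]]] := obs_sound (leqnn T) hy yd; rewrite /=.
by rewrite quiescent_stable.
Qed.

Section Match.

Variables x0 x1 : seq pos.
Hypotheses (LE : L = x0 ++ M ++ x1) (kE : k = size x0 + a).
Hypothesis BE : forall m : 'I_(size M), bc L (nth p0 M m) = B m.

Lemma nth_match m : m < size M -> nth p0 L (size x0 + m) = nth p0 M m.
Proof. by move=> hm; rewrite LE nth_cat ltnNge leq_addr /= addKn nth_cat hm. Qed.

(** The general's signal reaches index [m] after [dist m a] steps, and what is found there needs
    [dist x (size x0 + m)] more to reach [x]. *)
Lemma obs_complete t x : t <= T -> x < size L -> dist x k <= t ->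
  exists id K, [/\ st t x = inl (inord t, id, K),
    size x0 <= x < size x0 + size M -> omap val id = Some (x - size x0) &
    forall m : 'I_(size M), dist m a + dist x (size x0 + m) <= t -> m \in K].
Proof.
have kL : k < size L by case: C.
have sL : size L = size x0 + (size M + size x1) by rewrite LE !size_cat.
have uM : uniq M by case: C => _ _ _ + _; rewrite LE !cat_uniq => /and5P[].
elim: t x => [|t IH] x tT hx hd.
  have xk : x = k by move: hd; rewrite /dist; lia.
  have h0 : nth p0 L k = p0 by case: C.
  rewrite xk obs_run0 /obs_init insubT /=; do 2!eexists; split.
  - by congr (inl (_, _, _)); apply: val_inj; rewrite /= inordK.
  - by move=> _ /=; rewrite kE addKn.
  - move=> m; rewrite /dist => hm; have em : m = a :> nat by lia.
    rewrite /= -h0 kE nth_match // -BE /= eqxx inE.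
    by apply/eqP/val_inj.
have {}IH y : y < size L -> dist y k <= t -> _ := fun h => IH y (ltnW tT) h.
have hK (m : 'I_(size M)) : dist m a + dist x (size x0 + m) <= t.+1 -> x != size x0 + m ->
    m \in heard (nbf L (fun y => st t y) x).
  rewrite /dist => hm xm; apply/(heardP _ _ hx).
  pose y := if x < size x0 + m then x.+1 else x.-1.
  have hy : y < size L.
    have := ltn_ord m; rewrite /y; case: ifP => h; first by rewrite sL; lia.
    by move=> _; rewrite (leq_ltn_trans (leq_pred x)).
  exists y; split=> //; first by rewrite /y; case: ifP; lia.
  have yd : dist y k <= t by rewrite /y /dist kE; case: ifP; lia.
  have [id [K [-> _ h]]] := IH y hy yd.
  by apply: h; rewrite /dist /y; case: ifP; lia.
have [xd|xd] := leqP (dist x k) t.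
  have [id [K [xE h1 h2]]] := IH x hx xd.
  exists id, (K :|: heard (nbf L (fun y => st t y) x)); split=> //.
    by rewrite obs_run // xE /obs_step inordK ?tT //; lia.
  move=> m hm; rewrite inE; have [e|xm] := eqVneq x (size x0 + m); last by rewrite hK ?orbT.
  by rewrite h2 // -e; move: xd; rewrite e kE /dist; lia.
have snd y : y < size L -> dist y k <= t -> sound t y by apply: obs_sound; lia.
have [||||y [id [K [hy hxy yd yE xE]]]] := @pick_early t x; try lia; try by [].
have [id' [K' [yE' h1 _]]] := IH y hy yd.
move: yE'; rewrite yE => -[eid eK]; subst id' K'.
have hid : size x0 <= x < size x0 + size M ->
    omap val (shift_id id (dir L x y)) = Some (x - size x0).
  (* The general lies in the segment, hence so does the neighbour [y] closer to it, whose index is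
     known. *)
  move=> hxr; have hyr : size x0 <= y < size x0 + size M.
    by move: xd yd; rewrite kE /dist; lia.
  move: (h1 hyr); case: id {h1 yE xE} => //= m [mE].
  have hm : x - size x0 < size M by lia.
  rewrite (@pick_uniq _ _ (Ordinal hm)) //=.
    rewrite mE -!nth_match; try lia.
    by rewrite !subnKC ?(dirE C hx hy hxy) //; lia.
  move=> m' /eqP; rewrite mE -(nth_match (m := y - size x0)); last lia.
  rewrite subnKC; last lia.
  rewrite (dirE C hx hy hxy) => /padd_injl.
  rewrite -{1}(subnKC (m := size x0) (n := x)); last lia.
  rewrite nth_match // => /eqP; rewrite nth_uniq // => /eqP e.
  exact: val_inj.
do 2!eexists; split; [exact: xE|exact: hid|].
move=> m hm; rewrite inE; have [e|xm] := eqVneq x (size x0 + m); last by rewrite hK ?orbT.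
have hxr : size x0 <= x < size x0 + size M by have := ltn_ord m; lia.
move: (hid hxr); case: shift_id => //= m' [m'E].
have -> : m' = m by apply: val_inj; rewrite /= m'E e addKn.
by rewrite e nth_match // BE eqxx inE eqxx.
Qed.

Lemma obs_fires :
  (forall x (m : 'I_(size M)), x < size L -> dist m a + dist x (size x0 + m) <= T) ->
  fires_at observer L T.
Proof.
move=> h; split=> [t tT q|q /(nthP p0)[x hx <-]]; first exact: obs_nofire.
have xd : dist x k <= T.
  by apply: leq_trans (h x (Ordinal aM) hx); rewrite kE /=; lia.
have [id [K [-> _ hK]]] := obs_complete (leqnn T) hx xd.
rewrite /= inordK // eqxx /=; apply/eqP/setP => m.
by rewrite inE hK // h.
Qed.

End Match.
End Config.

(** If one node knows all of [M] at time [T], the configuration extends [M] with boundary conditions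
    [B], and by the distance bound every node knows it. Otherwise nobody fires at [T], and [A] fires
    later. *)
Lemma observer_solution :
  solution A -> uniq M -> (forall i, i.+1 < size M -> adj (nth p0 M i) (nth p0 M i.+1)) ->
  (forall x0 x1, is_config (x0 ++ M ++ x1) (size x0 + a) ->
     (forall m : 'I_(size M), bc (x0 ++ M ++ x1) (nth p0 M m) = B m) ->
     forall x (m : 'I_(size M)), x < size (x0 ++ M ++ x1) ->
       dist m a + dist x (size x0 + m) <= T) ->
  solution observer.
Proof.
move=> solA uM adjM far L k C.
have [h|h] := boolP (has (fun q => @firing observer (run observer L T q)) L); last first.
  have [t [t1 t2]] := solA L k C; exists (T.+1 + t); split=> [t' ht' q qL|q]; last first.
    by case/(nthP p0) => x hx <-; rewrite (obs_after C) //=; apply: t2; rewrite mem_nth.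
  have [tT|tT|->] := ltngtP t' T; first exact: (obs_nofire C).
    case/(nthP p0): (qL) => x hx <-.
    rewrite -(subnKC tT) (obs_after C) //=; apply: t1; last by rewrite mem_nth.
    by lia.
  by apply: contra h => hq; apply/hasP; exists q.
exists T; case/hasP: h => q /(nthP p0)[x hx <-].
have [xd|xd] := leqP (dist x k) T; last first.
  by rewrite (obs_quiet C) //= (negbTE (@quiescent_not_firing A)).
have [id [K [-> _ _ hK]]] := obs_sound C (leqnn T) hx xd.
move=> /= /andP[_ /eqP KT].
have {}hK (m : 'I_(size M)) : nth p0 M m \in L /\ bc L (nth p0 M m) = B m.
  by apply: hK; rewrite KT inE.
have sM : {subset M <= L}.
  by move=> z /(nthP p0)[m hm <-]; case: (hK (Ordinal hm)).
have [|L' [x0 [x1 [hL' LE]]]] := adj_chain_split C _ uM sM adjM.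
  by rewrite -size_eq0 -lt0n (leq_ltn_trans _ aM).
have [k' C'] : exists k', is_config L' k'.
  by case: hL' => ->; [exists k|exists (size L - k.+1); apply: config_rev].
have mL : L' =i L by case: hL' => -> z; rewrite ?mem_rev.
have kE : k' = size x0 + a.
  apply/eqP; rewrite eq_sym -(config_eq0 C'); first by rewrite (nth_match LE) // Ma.
  by rewrite LE !size_cat ltn_add2l (leq_trans aM) ?leq_addr.
have BE (m : 'I_(size M)) : bc L' (nth p0 M m) = B m by rewrite (bc_mem _ mL); case: (hK m).
apply: fires_mem mL _; apply: (obs_fires C' LE kE BE) => y m hy.
by subst k' L'; apply: (far x0 x1).
Qed.

End Observer.

(** * The minimum firing time *)

Lemma nat_least (P : nat -> Prop) : (exists n, P n) ->
  exists n, P n /\ forall m, P m -> n <= m.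
Proof.
case=> n Pn; apply: NNPP => no; elim/ltn_ind: n Pn => n IH Pn; apply: no.
by exists n; split=> // m Pm; rewrite leqNgt; apply/negP => /IH/(_ Pm).
Qed.

Definition bounds (P : nat -> Prop) (b : nat) : Prop :=
  (forall n, P n -> n <= b) /\ (forall b', (forall n, P n -> n <= b') -> b <= b').

Lemma esup_bounds P b : (forall n, P n -> n <= b) -> exists2 m, esup P = Some m & bounds P m.
Proof.
move=> hb; rewrite /esup; case: excluded_middle_informative => [ex|[]]; last by exists b.
exists (epsilon (inhabits 0) (bounds P)) => //; apply: epsilon_spec.
by case: (nat_least ex) => c [h1 h2]; exists c.
Qed.

Lemma esup_le P m n : esup P = Some m -> P n -> n <= m.
Proof.
move=> e Pn; have [b hb] : exists b, forall n, P n -> n <= b.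
  by move: e; rewrite /esup; case: excluded_middle_informative.
by have [m' + [h _]] := esup_bounds hb; rewrite e => -[->]; apply: h.
Qed.

Lemma esup_max P b : (exists n, P n) -> (forall n, P n -> n <= b) ->
  exists2 m, esup P = Some m & P m.
Proof.
move=> [n Pn] /esup_bounds[m e [h1 h2]]; exists m => //.
apply: NNPP => nP; have h c : P c -> c < m.
  by move=> Pc; rewrite ltn_neqAle h1 // andbT; apply/eqP => ec; apply: nP; rewrite -ec.
have := h2 m.-1; case: m h {e h1 h2 nP} => [/(_ n Pn)|m h /(_ h)] //.
by rewrite ltnn.
Qed.

(** * Integer indices and suprema in terms of extensions *)

Section Bridge.

Variables (L : seq pos) (k a b : nat).
Hypotheses (C : is_config L k) (ak : a <= k) (bk : k + b < size L).

Notation i := (- Posz a)%R.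
Notation j := (Posz b).

Lemma seg_mid : seg L k i j = mid L k a b.
Proof.
rewrite /seg /mid (_ : `|(j - i + 1)%R|%N = (a + b).+1); last lia.
by rewrite (_ : `|(k%:Z + i)%R|%N = k - a) //; lia.
Qed.

Lemma W_ext x0 x1 : W L k i j (x0, x1) <-> ext L k a b x0 x1.
Proof.
rewrite /W /= seg_mid (_ : `|(- i)%R|%N = a); last lia.
split=> -[h1 h2]; split=> // l hl.
  have := h2 (l%:Z - k%:Z)%R; rewrite /pt (_ : `|_|%N = l); last lia.
  by apply; lia.
by rewrite /pt; apply: h2; lia.
Qed.

Lemma range_ij : in_range L k i j.
Proof. by rewrite /in_range /rr /ss; lia. Qed.

Lemma valueE : value L k i j =
  emax (eadd (2 * a + b) (g L k i j)) (eadd (2 * b + a) (f L k i j)).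
Proof.
by rewrite /value; congr (emax (eadd _ _) (eadd _ _)); lia.
Qed.

Lemma value_le t x0 x1 : value L k i j = Some t -> ext L k a b x0 x1 ->
  2 * a + b + size x1 <= t /\ 2 * b + a + size x0 <= t.
Proof.
rewrite valueE => + /W_ext hx.
case Eg : g => [m|//]; case Ef : f => [n|//] [<-].
have hm : size x1 <= m by apply: (esup_le Eg); exists x1; split=> //; exists x0.
have hn : size x0 <= n by apply: (esup_le Ef); exists x0; split=> //; exists x1.
by rewrite leq_max leq_add2l hm leq_max leq_add2l hn orbT.
Qed.

(** Finitely many extensions bound both components, so the suprema are attained by actual
    extensions. *)
Lemma value_finite : finite_set (W L k i j) -> exists t x0 x1,
  [/\ value L k i j = Some t, ext L k a b x0 x1 &
      t = 2 * a + b + size x1 \/ t = 2 * b + a + size x0].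
Proof.
move=> [s hs]; have /W_ext w := ext_self C ak bk.
pose N := \max_(x <- s) (size x.1 + size x.2).
have hN x : W L k i j x -> size x.1 + size x.2 <= N.
  by move=> /hs xs; apply: (@leq_bigmax_seq _ s xpredT (fun x => size x.1 + size x.2)).
have [m Em [x1 [[y0 hx1] sx1]]] : exists2 m, g L k i j = Some m &
    exists x1, V L k i j x1 /\ size x1 = m.
  apply: (esup_max (b := N)); first by do 2!eexists; split; [eexists; exact: w|].
  by move=> _ [x1 [[x0 /hN h] <-]]; apply: leq_trans h; apply: leq_addl.
have [n En [x0 [[y1 hx0] sx0]]] : exists2 n, f L k i j = Some n &
    exists x0, U L k i j x0 /\ size x0 = n.
  apply: (esup_max (b := N)); first by do 2!eexists; split; [eexists; exact: w|].
  by move=> _ [x0' [[x1' /hN h] <-]]; apply: leq_trans h; apply: leq_addr.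
rewrite valueE Em En /=; move/W_ext: hx1 => hx1; move/W_ext: hx0 => hx0.
have [h|h] := leqP (2 * a + b + m) (2 * b + a + n).
  by exists (2 * b + a + n), x0, y1; split=> //; rewrite sx0; right.
exists (2 * a + b + m), y0, x1; split=> //; last by rewrite sx1; left.
Qed.

End Bridge.

Fixpoint reach (n : nat) : seq pos :=
  if n is m.+1 then reach m ++ [seq padd p (epsn (val e)) | p <- reach m, e <- enum 'I_4]
  else [:: p0].

Lemma config_reach L k n x : is_config L k -> x < size L -> dist x k <= n ->
  nth p0 L x \in reach n.
Proof.
rewrite /dist => C; have kL : k < size L by case: C.
elim: n x => [|n IH] x hx hd /=.
  rewrite (_ : x = k); last lia.
  by case: C => _ -> _ _ _; rewrite inE.
rewrite mem_cat; have [h|h] := leqP ((x - k) + (k - x)) n; first by rewrite IH.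
pose y := if x < k then x.+1 else x.-1.
have hy : y < size L.
  rewrite /y; case: ifP => h'; first exact: leq_ltn_trans kL.
  by rewrite (leq_ltn_trans (leq_pred x)).
have hyx : (y == x.+1) || (x == y.+1) by rewrite /y; case: ifP; lia.
apply/orP; right; rewrite (dirE C hy hx hyx); apply: allpairs_f; last by rewrite mem_enum.
by apply: IH => //; rewrite /y; case: ifP; lia.
Qed.

Fixpoint words (S : eqType) (s : seq S) (n : nat) : seq (seq S) :=
  if n is m.+1 then [::] :: [seq p :: w | p <- s, w <- words s m] else [:: [::]].

Lemma mem_words (S : eqType) (s w : seq S) n : size w <= n -> {subset w <= s} ->
  w \in words s n.
Proof.
elim: n w => [|n IH] [|p w] //= hw hs; rewrite inE; apply/orP; right.
apply: allpairs_f; first by apply: hs; rewrite inE eqxx.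
by apply: IH => // z hz; apply: hs; rewrite inE hz orbT.
Qed.

(** If all components had length at most [T], they would be words of bounded length over the finite
    set of positions near the general. *)
Lemma ext_unbounded L k a b T : a <= k -> k + b < size L ->
  ~ finite_set (W L k (- Posz a)%R (Posz b)) ->
  exists x0 x1, ext L k a b x0 x1 /\ (T < size x1 \/ T < size x0).
Proof.
move=> ak bk inf; apply: NNPP => no; apply: inf.
pose s := words (reach (T + (a + b).+1 + T)) T.
exists [seq (x, y) | x <- s, y <- s] => -[x0 x1] /(W_ext ak bk) hx.
have h0 : size x0 <= T.
  by rewrite leqNgt; apply/negP => h; apply: no; exists x0, x1; split; last right.
have h1 : size x1 <= T.
  by rewrite leqNgt; apply/negP => h; apply: no; exists x0, x1; split; last left.
have sub z : z \in x0 ++ mid L k a b ++ x1 -> z \in reach (T + (a + b).+1 + T).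
  case/(nthP p0) => x hxs <-; apply: (config_reach hx.1 hxs).
  have : x < size x0 + ((a + b).+1 + size x1) by rewrite -(size_mid ak bk) -!size_cat.
  by rewrite /dist; lia.
by apply: allpairs_f; apply: mem_words => // z hz; apply: sub; rewrite !mem_cat hz ?orbT.
Qed.

Theorem theorem7 (L : seq pos) (k : nat) :
  is_config L k -> CNI L k ->
  exists t : nat, is_min_value L k t /\ mft_is L t.
Proof.
move=> C cni; have kL : k < size L by case: C.
have rangeP i j : in_range L k i j ->
    exists a b, [/\ i = (- Posz a)%R, j = Posz b, a <= k & k + b < size L].
  rewrite /in_range /rr /ss => h; exists `|i|%N, `|j|%N; split; lia.
pose fin a b := finite_set (W L k (- Posz a)%R (Posz b)).
have bk : k + (size L - k.+1) < size L by lia.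
(* On the whole interval [[r, s]] both components are empty, by [end_nil] at either end; so the
   formula has at least one finite value. *)
have fin0 : fin k (size L - k.+1).
  exists [:: ([::], [::])] => -[x0 x1] /(W_ext (leqnn k) bk) hx.
  have sm := mid_split (leqnn k) bk; rewrite subnn take0 drop_oversize ?cats0 in sm; last lia.
  rewrite inE (end_nil bk _ hx); last by move=> z; rewrite mem_cat {1}sm => ->.
  have [C' _ bk' kk] := rev_hyps C (leqnn k) bk.
  have [_ hr] := ext_rev (leqnn k) bk hx.
  have : rev x1 = [::].
    apply: (end_nil bk' _ hr) => z.
    by rewrite mem_cat (mid_rev (leqnn k) bk) !mem_rev {1}sm => ->.
  by move/(congr1 rev); rewrite revK => ->.
have ext_value : exists t i j, in_range L k i j /\ value L k i j = Some t.
  have [t [_ [_ [vt _ _]]]] := value_finite C (leqnn k) bk fin0.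
  by do 3!eexists; split; [exact: (range_ij (leqnn k) bk)|exact: vt].
have [t [ht tmin]] := nat_least ext_value.
exists t; split.
  split=> // i j hij; case E : value => [n|//].
  by apply: tmin; exists i, j.
split.
  case: ht => i [j [/rangeP[a [b [-> -> ak bk1]]] vt]].
  have sm := size_mid ak bk1; have [hk h0 hadj uL _] := C.
  pose B (m : 'I_(size (mid L k a b))) := bc L (nth p0 (mid L k a b) m).
  have aM : a < size (mid L k a b) by rewrite sm; lia.
  have Ma : nth p0 (mid L k a b) a = p0 by rewrite nth_mid ?leq_addr // subnK.
  (* The slowest news goes from one end of the segment to the opposite end of the configuration, in
     time [a + (a + b + size x1)] or [b + (a + b + size x0)]: these are the two terms of the
     formula. *)
  have far x0 x1 : ext L k a b x0 x1 -> forall x (m : 'I_(size (mid L k a b))),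
      x < size (x0 ++ mid L k a b ++ x1) -> dist m a + dist x (size x0 + m) <= t.
    move=> hx x m hxs; have [h1 h2] := value_le ak bk1 vt hx.
    have : x < size x0 + ((a + b).+1 + size x1) by rewrite -sm -!size_cat.
    by have := ltn_ord m; rewrite {2}sm /dist; lia.
  exists (@observer squad t (mid L k a b) a B); split.
    apply: observer_solution => //; first exact: squad_solution.
    - by rewrite take_uniq // drop_uniq.
    - move=> m; rewrite sm => hm; rewrite !nth_mid //; last lia.
      by rewrite addnS; apply: hadj; lia.
    - move=> x0 x1 Cx bE; apply: far; split=> // c hc.
      have hm : c - (k - a) < size (mid L k a b) by rewrite sm; lia.
      have := bE (Ordinal hm); rewrite /B /= nth_mid ?subnKC //; lia.
  have hself := ext_self C ak bk1; have eL := mid_split ak bk1.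
  apply: (obs_fires squad aM Ma C eL) => //.
  - by rewrite size_take (_ : k - a < size L) ?subnK //; lia.
  - by move=> x m hxs; apply: (far _ _ hself); rewrite -eL.
move=> A t' solA ft; rewrite leqNgt; apply/negP => tt.
apply: (no_fire (T := t') solA C fin0) ft.
- move=> a b ak bk1 /(value_finite C ak bk1)[s [x0 [x1 [vs hx hs]]]].
  have ts : t <= s by apply: tmin; do 2!eexists; split; [exact: (range_ij ak bk1)|exact: vs].
  exists x0, x1; split=> //; case: hs => e; [left|right]; lia.
- by move=> a b ak bk1; apply: ext_unbounded.
move=> a b ak bk1 hab x0 y1 y0 x1 /(W_ext ak bk1) hx /(W_ext ak bk1) hy.
apply/(W_ext ak bk1); apply/cni.
- exact: range_ij.
(* A finite interval is in [K]; an infinite one entered from a finite one is in [I] or [J],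
   according to the end that moved. *)
- case: (classic (fin a b)) => nf; first by right; right.
  case: hab => // -[lt fab]; [left|right; left]; (split; [rewrite /rr /ss; lia|split=> //]).
    by rewrite (_ : (- Posz a - 1)%R = (- Posz a.+1)%R) //; lia.
  by rewrite (_ : (Posz b + 1)%R = Posz b.+1) //; lia.
- by split; [exists y1|exists y0].
Qed.
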